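(* Let $\Psi$ be a bounded set of nonnegative matrices that define operators on $\ell^2$, let $r\in\{\rho_{ess},\hat\rho_{ess}\}$, and let $\alpha,\beta\ge0$ with $\alpha+\beta\ge1$. For $n\in\mathbb{N}\cup\{0\}$ put $r_n=r(S_{\alpha,\beta}(\Psi^{2^n}))^{2^{-n}}$. Then for every $n$, $$r(S_{\alpha,\beta}(\Psi))=r_0\le r_1\le\cdots\le r_n\le r(\Psi)^{\alpha+\beta}.$$
   Context: A nonnegative matrix $A=[a_{ij}]_{i,j\in\mathbb{N}}$ defines an operator on $\ell^2$ if $(Ax)_i=\sum_j a_{ij}x_j$ converges absolutely and $Ax\in\ell^2$ for all $x\in\ell^2$; $A^*$ is its transpose. Hadamard power $A^{(t)}=[a_{ij}^t]$, Hadamard product $A\circ B=[a_{ij}b_{ij}]$. $\Psi^n=\{A_1\cdots A_n:A_i\in\Psi\}$, $\Psi^*=\{A^*:A\in\Psi\}$. $S_{\alpha,\beta}(\Psi)=\{A^{(\alpha)}\circ(B^* )^{(\beta)}:A,B\in\Psi\}$, with the convention that a Hadamard factor with exponent $0$ is omitted. $\gamma$ is the Hausdorff measure of noncompactness, $\rho_{ess}$ the essential spectral radius; for a bounded set $\Sigma$, $\rho_{ess}(\Sigma)=\sup_m[\sup_{A\in\Sigma^m}\rho_{ess}(A)]^{1/m}$ and $\hat\rho_{ess}(\Sigma)=\lim_{m\to\infty}[\sup_{A\in\Sigma^m}\gamma(A)]^{1/m}$. *)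

(* Defs.v *)
From HB Require Import structures.
From mathcomp Require Import all_boot all_order all_algebra.
From mathcomp Require Import all_classical all_reals all_analysis.
Set Implicit Arguments. Unset Strict Implicit. Unset Printing Implicit Defensive.
Import Order.TTheory GRing.Theory Num.Theory.
Import numFieldNormedType.Exports.
Local Open Scope classical_set_scope.
Local Open Scope ring_scope.

Section L2.
Variable R : realType.

Definition vec := nat -> R.

Definition rsum (u : nat -> R) : R := limn (fun n => \sum_(0 <= k < n) u k).
Definition mx := nat -> nat -> R.

Definition l2 (x : vec) : Prop :=
  (\sum_(0 <= k <oo) ((x k) ^+ 2)%:E < +oo)%E.

Definition l2norm (x : vec) : R :=
  Num.sqrt (fine (\sum_(0 <= k <oo) ((x k) ^+ 2)%:E)%E).

Definition mxapp (A : mx) (x : vec) : vec :=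
  fun i => rsum (fun j => A i j * x j).

Definition nonneg_mx (A : mx) : Prop := forall i j, 0 <= A i j.

Definition defines_operator (A : mx) : Prop :=
  forall x, l2 x ->
    (forall i, (\sum_(0 <= j <oo) (`|A i j * x j|%:E) < +oo)%E) /\
    l2 (mxapp A x).

Definition l2op := vec -> vec.

Definition opnorm (T : l2op) : R :=
  sup [set l2norm (T x) | x in [set x | l2 x /\ l2norm x <= 1]].

Definition bounded_linear_op (T : l2op) : Prop :=
  (forall x, l2 x -> l2 (T x)) /\
  (forall x y (a : R), l2 x -> l2 y -> T (a *: x + y) = a *: T x + T y) /\
  (exists C, forall x, l2 x -> l2norm (T x) <= C * l2norm x).

Definition compact_op (K : l2op) : Prop :=
  bounded_linear_op K /\
  forall u : nat -> vec, (forall n, l2 (u n) /\ l2norm (u n) <= 1) ->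
    exists (phi : nat -> nat) (y : vec),
      (forall n, (phi n < phi n.+1)%N) /\ l2 y /\
      ((fun n => l2norm (K (u (phi n)) - y)) @ \oo --> (0 : R)).

Definition ess_norm (T : l2op) : R :=
  inf [set opnorm (T - K) | K in compact_op].

Definition mxmul (A B : mx) : mx :=
  fun i j => rsum (fun k => A i k * B k j).
Definition idmx : mx := fun i j => (i == j)%:R.
Fixpoint mxpow (A : mx) (m : nat) : mx :=
  match m with 0 => idmx | m'.+1 => mxmul A (mxpow A m') end.
Definition mxtr (A : mx) : mx := fun i j => A j i.
Definition hpow (A : mx) (t : R) : mx := fun i j => A i j `^ t.
Definition hmul (A B : mx) : mx := fun i j => A i j * B i j.

Fixpoint setpow (Psi : set mx) (n : nat) : set mx :=
  match n with
  | 0 => [set idmx]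
  | 0.+1 => Psi
  | n'.+1 => [set mxmul A B | A in Psi & B in setpow Psi n']
  end.

(* S_{alpha,beta}(Psi); powR gives a `^ 0 = 1 (also for a = 0), so a Hadamard
   factor with exponent 0 is the all-ones matrix, i.e. it is omitted. *)
Definition Sab (alpha beta : R) (Psi : set mx) : set mx :=
  [set hmul (hpow A alpha) (hpow (mxtr B) beta) | A in Psi & B in Psi].

Definition bdd_opset (Psi : set mx) : Prop :=
  exists C, forall A, Psi A -> opnorm (mxapp A) <= C.

Definition hmnc (A : mx) : R :=
  inf [set e : R | 0 <= e /\
     exists s : seq vec, (forall y, y \in s -> l2 y) /\
       forall x, l2 x -> l2norm x <= 1 ->
         exists2 y, y \in s & l2norm (mxapp A x - y) <= e].

(* essential spectral radius of a single operator (Gelfand formula in the Calkin algebra) *)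
Definition rho_ess (A : mx) : R :=
  limn (fun m => ess_norm (mxapp (mxpow A m)) `^ (m%:R)^-1).

Definition rho_ess_set (Sigma : set mx) : R :=
  sup [set (sup [set rho_ess A | A in setpow Sigma m]) `^ (m%:R)^-1
       | m in [set m : nat | (0 < m)%N]].

Definition rho_hat_ess_set (Sigma : set mx) : R :=
  limn (fun m => (sup [set hmnc A | A in setpow Sigma m]) `^ (m%:R)^-1).

End L2.

(* Main.v *)
Require Import Defs.
From HB Require Import structures.
From mathcomp Require Import all_boot all_order all_algebra.
From mathcomp Require Import all_classical all_reals all_analysis.
From mathcomp Require Import ring lra.
Set Implicit Arguments. Unset Strict Implicit. Unset Printing Implicit Defensive.
Import Order.TTheory GRing.Theory Num.Theory.
Import numFieldNormedType.Exports.
Local Open Scope classical_set_scope.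
Local Open Scope ring_scope.

(* A nonnegative matrix A has operator norm at most c iff its finite bilinear
   form satisfies sum_ij y_i A_ij x_j <= c |y| |x| for nonnegative y and x.
   This condition is visibly symmetric under transposition and monotone in the
   entries, and Hoelder's inequality gives
   ||A^(s) o B^(t)|| <= ||A||^s ||B||^t when s + t >= 1.  Let tau A be the limit
   of the norms of A with its first n rows erased.  On l2 both the Hausdorff
   measure of noncompactness and the essential norm of A equal tau A, and tau
   is monotone, submultiplicative, transpose invariant and satisfies the same
   Hadamard inequality.  By Hoelder for the entries of a product, every product
   of m members of S_{s,t}(Phi) is dominated entrywise by a member of
   S_{s,t}(Phi^m).  Writing S(Phi)^(2m) = (S(Phi)^2)^m, the case of two factors
   gives r(S_{s,t}(Phi)) <= r(S_{s,t}(Phi^2))^(1/2), and the case of m factors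
   gives r(S_{s,t}(Phi)) <= r(Phi)^(s+t). *)

(** [hmnc] and [ess_norm] are infima over arbitrary finite sets and arbitrary compact operators, so
    neither is visibly monotone in the entries; [tau] is, and it serves both choices of r at once.
    Equality with [tau] rests on a fact about l2: a bounded set is relatively compact exactly when
    its tails are uniformly small. The price is that [tau] erases rows only, so its invariance under
    transposition is a theorem; it holds because finitely many rows of a bounded matrix form a
    compact operator.

    Default values shape the rest. [rsum] and [limn] return a default on divergent sequences, and a
    real [sup] is 0 on an unbounded set. A bound on [opnorm] therefore says nothing about an
    unbounded operator, and each matrix is first shown bounded from [defines_operator].
    Associativity of products is stated within [opmx], and every limit of roots is first shown to
    exist. *)

Section Sums.
Variable R : realType.
Implicit Types (u v x y : nat -> R) (c : R).

(** * Series of reals and Euclidean norms of finite segments *)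

Lemma ler_sum_range M N u : (forall k, 0 <= u k) -> (M <= N)%N ->
  \sum_(0 <= k < M) u k <= \sum_(0 <= k < N) u k.
Proof.
move=> u0 MN; rewrite (big_cat_nat (leq0n M) MN) /= lerDl.
exact: sumr_ge0.
Qed.

Lemma ler_sum_term N u k : (forall k, 0 <= u k) -> (k < N)%N ->
  u k <= \sum_(0 <= k < N) u k.
Proof.
move=> u0 kN; apply: (le_trans _ (ler_sum_range u0 kN)).
by rewrite big_nat_recr //= lerDr sumr_ge0.
Qed.

Definition sums_bounded u := exists c, forall N, \sum_(0 <= k < N) u k <= c.

Lemma nonneg_rsum_cvg u : (forall k, 0 <= u k) -> sums_bounded u ->
  (\sum_(0 <= k < n) u k @[n --> \oo] --> rsum u).
Proof.
move=> u0 [c uc]; apply: nondecreasing_is_cvgn.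
  by move=> m n; exact: ler_sum_range.
by exists c => _ [n _ <-].
Qed.

Lemma rsum_unique u l : \sum_(0 <= k < n) u k @[n --> \oo] --> l -> rsum u = l.
Proof. exact: cvg_lim. Qed.

Lemma sum_le_rsum u : (forall k, 0 <= u k) -> sums_bounded u ->
  forall N, \sum_(0 <= k < N) u k <= rsum u.
Proof.
move=> u0 su N; apply: (nondecreasing_cvgn_le (u_ := fun n => \sum_(0 <= k < n) u k)).
  by move=> m n; exact: ler_sum_range.
apply/cvg_ex; exists (rsum u); exact: nonneg_rsum_cvg.
Qed.

Lemma rsum_le u c : (forall k, 0 <= u k) ->
  (forall N, \sum_(0 <= k < N) u k <= c) -> rsum u <= c.
Proof.
move=> u0 uc; apply: limr_le; last by near=> n.
apply/cvg_ex; exists (rsum u); apply: nonneg_rsum_cvg => //; by exists c.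
Unshelve. all: by end_near. Qed.

(** A divergent series is covered too: [limn] then returns the default point of R, which is 0. *)
Lemma rsum_ge0 u : (forall k, 0 <= u k) -> 0 <= rsum u.
Proof.
move=> u0; case: (pselect (sums_bounded u)) => [su|nu].
  by apply: le_trans (sum_le_rsum u0 su 0); rewrite big_geq.
rewrite /rsum dvgP //; move=> h; apply: nu.
by exists (rsum u) => N; apply: (nondecreasing_cvgn_le (u_ := fun n => \sum_(0 <= k < n) u k)) => // m n; exact: ler_sum_range.
Qed.

Lemma rsum0 : rsum (fun=> 0 : R) = 0.
Proof.
apply: rsum_unique; apply: cvg_near_cst; near=> n; exact: big1.
Unshelve. all: by end_near. Qed.

Lemma ler_rsum u v : (forall k, 0 <= u k <= v k) -> sums_bounded v ->
  rsum u <= rsum v.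
Proof.
move=> uv sv; have u0 k : 0 <= u k by case/andP: (uv k).
have v0 k : 0 <= v k by case/andP: (uv k); exact: le_trans.
apply: rsum_le => // N; apply: le_trans (sum_le_rsum v0 sv N).
by apply: ler_sum_nat => k _; case/andP: (uv k).
Qed.

Lemma rsum_finite u N : (forall k, (N <= k)%N -> u k = 0) ->
  rsum u = \sum_(0 <= k < N) u k.
Proof.
move=> u0; apply: rsum_unique; apply: cvg_near_cst; near=> n.
have Nn : (N <= n)%N by near: n; exists N.
rewrite (big_cat_nat (leq0n N) Nn) /= [X in _ + X]big_nat_cond [X in _ + X]big1 ?addr0 //.
by move=> k /andP[/andP[Nk _] _]; exact: u0.
Unshelve. all: by end_near. Qed.

Lemma rsum_cvg u : sums_bounded (fun k => `|u k|) ->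
  (\sum_(0 <= k < n) u k @[n --> \oo] --> rsum u).
Proof.
move=> su; apply: (@normed_cvg _ _ u).
have := nonneg_rsum_cvg (fun k => normr_ge0 (u k)) su.
by move=> /cvgP.
Qed.

Lemma sums_bounded_norm u : (forall k, 0 <= u k) -> sums_bounded u ->
  sums_bounded (fun k => `|u k|).
Proof. by move=> u0 [c uc]; exists c => N; under eq_bigr do rewrite ger0_norm //. Qed.

Lemma rsumD u v : sums_bounded (fun k => `|u k|) ->
  sums_bounded (fun k => `|v k|) ->
  rsum (fun k => u k + v k) = rsum u + rsum v.
Proof.
move=> su sv; apply: rsum_unique.
under eq_fun do rewrite big_split /=.
by apply: cvgD; exact: rsum_cvg.
Qed.

Lemma rsumZ c u : sums_bounded (fun k => `|u k|) ->
  rsum (fun k => c * u k) = c * rsum u.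
Proof.
move=> su; apply: rsum_unique.
under eq_fun do rewrite -mulr_sumr.
by apply: cvgMr; exact: rsum_cvg.
Qed.

Lemma ler_norm_rsum u : sums_bounded (fun k => `|u k|) ->
  `|rsum u| <= rsum (fun k => `|u k|).
Proof.
move=> su; have h := rsum_cvg su.
rewrite -(cvg_lim _ (cvg_norm h)) //; apply: limr_le; first exact: cvgP (cvg_norm h).
near=> n; apply: le_trans (ler_norm_sum _ _ _) _.
by apply: (sum_le_rsum (u := fun k => `|u k|)).
Unshelve. all: by end_near. Qed.

Lemma cvg_sum_range (f : nat -> nat -> R) (l : nat -> R) N :
  (forall i, (i < N)%N -> f i n @[n --> \oo] --> l i) ->
  \sum_(0 <= i < N) f i n @[n --> \oo] --> \sum_(0 <= i < N) l i.
Proof.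
elim: N => [|N IH] h.
  by rewrite big_geq //; apply: cvg_near_cst; near=> n; rewrite big_geq.
rewrite big_nat_recr //=; under eq_fun do rewrite big_nat_recr //=.
by apply: cvgD; [apply: IH => i iN; apply: h; exact: ltnW|exact: h].
Unshelve. all: by end_near. Qed.

Lemma sum_rsum (f : nat -> nat -> R) N :
  (forall i, (i < N)%N -> sums_bounded (fun k => `|f i k|)) ->
  \sum_(0 <= i < N) rsum (f i) = rsum (fun k => \sum_(0 <= i < N) f i k).
Proof.
move=> h; apply/esym/rsum_unique.
under eq_fun do rewrite exchange_big /=.
by apply: cvg_sum_range => i iN; apply: rsum_cvg; exact: h.
Qed.

(** One half of Tonelli's theorem. Its hypothesis is symmetric in the two indices, so a second
    application with the indices swapped gives equality. *)
Lemma rsum_exchange (f : nat -> nat -> R) c : (forall i j, 0 <= f i j) ->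
  (forall M N, \sum_(0 <= i < M) \sum_(0 <= j < N) f i j <= c) ->
  rsum (fun i => rsum (f i)) <= rsum (fun j => rsum (f^~ j)).
Proof.
move=> f0 fc.
have srow i : sums_bounded (f i).
  exists c => N; apply: le_trans (fc i.+1 N).
  apply: (ler_sum_term (u := fun i => \sum_(0 <= j < N) f i j)) => // k.
  exact: sumr_ge0.
have scol j : sums_bounded (f^~ j).
  exists c => M; apply: le_trans (fc M j.+1).
  apply: ler_sum_nat => i _; exact: (ler_sum_term (u := f i)).
have nrow i := sums_bounded_norm (f0 i) (srow i).
have sc : sums_bounded (fun j => rsum (f^~ j)).
  exists c => N; rewrite sum_rsum; last first.
    by move=> j _; apply: sums_bounded_norm.
  apply: rsum_le => [k|M]; first exact: sumr_ge0.
  exact: fc.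
apply: rsum_le => [i|M]; first exact: rsum_ge0.
rewrite sum_rsum //; apply: ler_rsum => // j; apply/andP; split.
  exact: sumr_ge0.
exact: sum_le_rsum.
Qed.

Lemma cauchy_schwarz_sum u v N :
  \sum_(0 <= k < N) u k * v k <=
  Num.sqrt (\sum_(0 <= k < N) u k ^+ 2) * Num.sqrt (\sum_(0 <= k < N) v k ^+ 2).
Proof.
elim: N => [|N IH]; first by rewrite !big_geq // sqrtr0 mulr0.
rewrite !big_nat_recr //=; set U := \sum_(0 <= k < N) u k ^+ 2.
set V := \sum_(0 <= k < N) v k ^+ 2.
have U0 : 0 <= U by apply: sumr_ge0 => k _; exact: sqr_ge0.
have V0 : 0 <= V by apply: sumr_ge0 => k _; exact: sqr_ge0.
apply: (le_trans (lerD IH (lexx _))); rewrite -/U -/V.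
rewrite -[leRHS]sqrtrM ?addr_ge0 ?sqr_ge0 //.
apply: le_trans (ler_norm _) _; rewrite -sqrtr_sqr; apply: ler_wsqrtr.
rewrite -{2}(sqr_sqrtr U0) -{2}(sqr_sqrtr V0).
set a := Num.sqrt U; set b := Num.sqrt V.
have := sqr_ge0 (a * v N - b * u N); nra.
Qed.

Definition enorm u N := Num.sqrt (\sum_(0 <= k < N) u k ^+ 2).

Lemma enorm_ge0 u N : 0 <= enorm u N. Proof. exact: sqrtr_ge0. Qed.

Lemma sqr_enorm u N : enorm u N ^+ 2 = \sum_(0 <= k < N) u k ^+ 2.
Proof. by rewrite sqr_sqrtr // sumr_ge0 // => k _; exact: sqr_ge0. Qed.

Lemma enorm_le u N c : 0 <= c -> \sum_(0 <= k < N) u k ^+ 2 <= c ^+ 2 ->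
  enorm u N <= c.
Proof. by move=> c0 h; rewrite -(ger0_norm c0) -sqrtr_sqr; apply: ler_wsqrtr. Qed.

Lemma ler_enorm u v N : (forall k, (k < N)%N -> `|u k| <= `|v k|) ->
  enorm u N <= enorm v N.
Proof.
move=> h; apply: ler_wsqrtr; apply: ler_sum_nat => k /andP[_ kN].
by rewrite -[u k ^+ 2]real_normK ?num_real // -[v k ^+ 2]real_normK ?num_real // lerXn2r ?nnegrE // h.
Qed.

Lemma enormD u v N : enorm (fun k => u k + v k) N <= enorm u N + enorm v N.
Proof.
apply: enorm_le; first by rewrite addr_ge0 ?enorm_ge0.
have -> : \sum_(0 <= k < N) (u k + v k) ^+ 2 =
  \sum_(0 <= k < N) u k ^+ 2 + (\sum_(0 <= k < N) u k * v k) *+ 2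
  + \sum_(0 <= k < N) v k ^+ 2.
  by rewrite -sumrMnl -!big_split /=; apply: eq_bigr => k _; rewrite sqrrD.
have := @cauchy_schwarz_sum u v N; rewrite -/(enorm u N) -/(enorm v N).
rewrite -!sqr_enorm sqrrD; lra.
Qed.

Lemma enormZ c u N : enorm (fun k => c * u k) N = `|c| * enorm u N.
Proof.
rewrite /enorm; under eq_bigr do rewrite exprMn.
by rewrite -mulr_sumr sqrtrM ?sqr_ge0 // sqrtr_sqr.
Qed.

Lemma enorm_term u N k : (k < N)%N -> `|u k| <= enorm u N.
Proof.
move=> kN; rewrite -sqrtr_sqr; apply: ler_wsqrtr.
by apply: (ler_sum_term (u := fun k => u k ^+ 2)) => // j; exact: sqr_ge0.
Qed.

Lemma enorm_range u M N : (M <= N)%N -> enorm u M <= enorm u N.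
Proof.
by move=> MN; apply: ler_wsqrtr; rewrite ler_sum_range // => k; exact: sqr_ge0.
Qed.

Lemma cauchy_schwarz_enorm u v N :
  \sum_(0 <= k < N) u k * v k <= enorm u N * enorm v N.
Proof. exact: cauchy_schwarz_sum. Qed.

End Sums.

(** * Hoelder's inequality for exponents with sum at least 1, and continuity of real powers *)

Section Hoelder.
Variable R : realType.
Implicit Types (u v : nat -> R) (a b c d s : R).

Lemma weighted_AMGM a b s t : 0 <= a -> 0 <= b -> 0 <= s -> 0 <= t ->
  s + t = 1 -> a `^ s * b `^ t <= s * a + t * b.
Proof.
move=> a0 b0 s0 t0 st.
have [s00|sn0] := eqVneq s 0.
  have -> : t = 1 by rewrite -st s00 add0r.
  by rewrite s00 powRr0 powRr1 // mul0r add0r.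
have [t00|tn0] := eqVneq t 0.
  have -> : s = 1 by rewrite -st t00 addr0.
  by rewrite t00 powRr0 powRr1 // mul0r addr0 mulr1 mul1r.
have sp : 0 < s by rewrite lt_def sn0.
have tp : 0 < t by rewrite lt_def tn0.
have := @conjugate_powR R (a `^ s) (b `^ t) s^-1 t^-1 (powR_ge0 _ _) (powR_ge0 _ _).
rewrite !invr_gt0 !invrK -!powRrM !divff // !powRr1 // => h.
by rewrite mulrC [_ * a]mulrC [_ * b]mulrC mulrC; exact: h.
Qed.

Lemma le_powR a b s : 0 <= a -> 0 <= s -> a <= b -> a `^ s <= b `^ s.
Proof.
by move=> a0 s0 ab; apply: ge0_ler_powR; rewrite ?nnegrE //; exact: le_trans ab.
Qed.

Lemma powR_addM a s t : 0 <= s -> 0 <= t -> a `^ (s + t) = a `^ s * a `^ t.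
Proof.
move=> s0 t0; have [st|st] := eqVneq (s + t) 0; last by rewrite powRD // (negbTE st).
have [-> ->] : s = 0 /\ t = 0 by split; lra.
by rewrite addr0 powRr0 mulr1.
Qed.

(** Each term is at most the total U, so u_k^s = u_k u_k^(s-1) is at most u_k U^(s-1). *)
Lemma sum_powR_le u s N : (forall k, 0 <= u k) -> 1 <= s ->
  \sum_(0 <= k < N) u k `^ s <= (\sum_(0 <= k < N) u k) `^ s.
Proof.
move=> u0 s1; set U := \sum_(0 <= k < N) u k.
have U0 : 0 <= U by exact: sumr_ge0.
have sp : 0 < s by lra.
rewrite -(mulr_powRB1 U0 sp) [in leRHS]/U mulr_suml.
apply: ler_sum_nat => k /andP[_ kN]; rewrite -mulr_powRB1 // ler_wpM2l //.
by apply: le_powR => //; [lra|exact: ler_sum_term].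
Qed.

Lemma hoelder_sum1 u v s t N : (forall k, 0 <= u k) -> (forall k, 0 <= v k) ->
  0 <= s -> 0 <= t -> s + t = 1 ->
  \sum_(0 <= k < N) u k `^ s * v k `^ t <=
  (\sum_(0 <= k < N) u k) `^ s * (\sum_(0 <= k < N) v k) `^ t.
Proof.
move=> u0 v0 s0 t0 st; set U := \sum_(0 <= k < N) u k; set V := \sum_(0 <= k < N) v k.
have U0 : 0 <= U by exact: sumr_ge0.
have V0 : 0 <= V by exact: sumr_ge0.
have [s00|sn0] := eqVneq s 0.
  have -> : t = 1 by rewrite -st s00 add0r.
  by rewrite s00 powRr0 powRr1 // mul1r; apply: ler_sum_nat => k _; rewrite powRr0 powRr1 // mul1r.
have [t00|tn0] := eqVneq t 0.
  have -> : s = 1 by rewrite -st t00 addr0.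
  by rewrite t00 powRr0 powRr1 // mulr1; apply: ler_sum_nat => k _; rewrite powRr0 powRr1 // mulr1.
have [U00|Un0] := eqVneq U 0.
  rewrite U00 powR0 // mul0r big_nat_cond big1 // => k /andP[/andP[_ kN] _].
  have -> : u k = 0 by apply/eqP; rewrite eq_le u0 andbT -U00; exact: ler_sum_term.
  by rewrite powR0 // mul0r.
have [V00|Vn0] := eqVneq V 0.
  rewrite V00 powR0 // mulr0 big_nat_cond big1 // => k /andP[/andP[_ kN] _].
  have -> : v k = 0 by apply/eqP; rewrite eq_le v0 andbT -V00; exact: ler_sum_term.
  by rewrite powR0 // mulr0.
have Up : 0 < U by rewrite lt_def Un0.
have Vp : 0 < V by rewrite lt_def Vn0.
(* Dividing by the totals U and V reduces to sums equal to 1, where the weighted AM-GM bounds add up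
   to s + t = 1. *)
have e k : u k `^ s * v k `^ t = U `^ s * V `^ t * ((u k / U) `^ s * (v k / V) `^ t).
  rewrite -{1}(divfK Un0 (u k)) -{1}(divfK Vn0 (v k)).
  by rewrite [(_ * U) `^ s]powRM ?[(_ * V) `^ t]powRM ?divr_ge0 //; ring.
under eq_bigr do rewrite e.
rewrite -mulr_sumr ger_pMr ?mulr_gt0 ?powR_gt0 //.
apply: (@le_trans _ _ (\sum_(0 <= k < N) (s * (u k / U) + t * (v k / V)))).
  by apply: ler_sum_nat => k _; apply: weighted_AMGM; rewrite ?divr_ge0.
by rewrite big_split /= -!mulr_sumr -!mulr_suml -/U -/V !divff // !mulr1 st.
Qed.

Lemma powR_mul_div a b s t : 0 <= a -> 0 <= b -> 0 < s + t ->
  (a `^ (s / (s + t)) * b `^ (t / (s + t))) `^ (s + t) = a `^ s * b `^ t.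
Proof.
move=> a0 b0 st; rewrite powRM ?powR_ge0 // -!powRrM !divfK //; exact: lt0r_neq0.
Qed.

(** The exponents s / (s + t) and t / (s + t) have sum 1; the outer power s + t >= 1 that remains is
    handled by [sum_powR_le]. *)
Lemma hoelder_sum u v s t N : (forall k, 0 <= u k) -> (forall k, 0 <= v k) ->
  0 <= s -> 0 <= t -> 1 <= s + t ->
  \sum_(0 <= k < N) u k `^ s * v k `^ t <=
  (\sum_(0 <= k < N) u k) `^ s * (\sum_(0 <= k < N) v k) `^ t.
Proof.
move=> u0 v0 s0 t0 st; have stp : 0 < s + t by lra.
under eq_bigr do rewrite -powR_mul_div //.
rewrite -[leRHS]powR_mul_div ?sumr_ge0 //.
apply: le_trans (sum_powR_le _ _ st) _ => [k|]; first by rewrite mulr_ge0 ?powR_ge0.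
apply: le_powR; [by apply: sumr_ge0 => k _; rewrite mulr_ge0 ?powR_ge0|exact: ltW|].
by apply: hoelder_sum1; rewrite ?divr_ge0 ?(ltW stp) // -mulrDl divff // lt0r_neq0.
Qed.

Lemma hoelder_rsum u v s t : (forall k, 0 <= u k) -> (forall k, 0 <= v k) ->
  sums_bounded u -> sums_bounded v ->
  0 <= s -> 0 <= t -> 1 <= s + t ->
  forall N, \sum_(0 <= k < N) u k `^ s * v k `^ t <= rsum u `^ s * rsum v `^ t.
Proof.
move=> u0 v0 su sv s0 t0 st N; apply: le_trans (hoelder_sum _ _ _ s0 t0 st) _ => //.
by apply: ler_pM; rewrite ?powR_ge0 //; apply: le_powR; rewrite ?sumr_ge0 // sum_le_rsum.
Qed.

(** Differentiability gives continuity only at a > 0. At a = 0 with s > 0 the threshold e^(1/s)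
    works, and for s = 0 everything is the constant 1, also at 0. *)
Lemma cvg_powR (w : nat -> R) a s : 0 <= s -> (forall n, 0 <= w n) ->
  w n @[n --> \oo] --> a -> w n `^ s @[n --> \oo] --> a `^ s.
Proof.
move=> s0 w0 wa.
have a0 : 0 <= a.
  by rewrite -(cvg_lim (@Rhausdorff R) wa); apply: limr_ge; [exact: cvgP wa|exact: nearW].
have [->|sn0] := eqVneq s 0.
  by rewrite powRr0; under eq_fun do rewrite powRr0; exact: cvg_cst.
have sp : 0 < s by rewrite lt_def sn0.
have [aa|an0] := eqVneq a 0.
  rewrite aa powR0 //; apply/cvgrPdist_lt => e e0.
  have e1 : 0 < e `^ s^-1 by rewrite powR_gt0.
  move/cvgrPdist_lt : wa => /(_ _ e1); apply: filterS => n.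
  rewrite aa !sub0r !normrN !ger0_norm ?powR_ge0 // => h.
  have -> : e = (e `^ s^-1) `^ s by rewrite -powRrM mulVf // powRr1 // ltW.
  by apply: gt0_ltr_powR; rewrite // nnegrE ?powR_ge0.
have ap : 0 < a by rewrite lt_def an0.
suff : {for a, continuous (fun x : R => x `^ s)} by exact: cvg_comp wa.
apply: differentiable_continuous; apply/derivable1_diffP.
by apply: derivable_powR; rewrite in_itv /= ap.
Qed.

End Hoelder.

(** * Matrices with bounded bilinear form: products, transposes, Hadamard powers *)

Section Forms.
Variable R : realType.
Implicit Types (A B C : mx R) (x y : nat -> R) (c d s t : R).

Definition mxform A M N y x :=
  \sum_(0 <= i < M) \sum_(0 <= j < N) y i * A i j * x j.

Definition mxbound A c := forall M N y x,
  (forall i, 0 <= y i) -> (forall j, 0 <= x j) ->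
  mxform A M N y x <= c * (enorm y M * enorm x N).

Definition opmx A := nonneg_mx A /\ exists c, mxbound A c.

Lemma mxformE A M N y x : mxform A M N y x =
  \sum_(0 <= i < M) y i * (\sum_(0 <= j < N) A i j * x j).
Proof.
by apply: eq_bigr => i _; rewrite mulr_sumr; apply: eq_bigr => j _; rewrite mulrA.
Qed.

Lemma ler_mxform A B M N y x : (forall i, 0 <= y i) -> (forall j, 0 <= x j) ->
  (forall i j, A i j <= B i j) -> mxform A M N y x <= mxform B M N y x.
Proof.
move=> y0 x0 AB; apply: ler_sum_nat => i _; apply: ler_sum_nat => j _.
by rewrite ler_wpM2r // ler_wpM2l.
Qed.

Lemma enorm_delta i : enorm (fun k => (k == i)%:R : R) i.+1 = 1.
Proof.
rewrite /enorm big_nat_recr //= eqxx expr1n big_nat_cond big1 ?add0r ?sqrtr1 //.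
by move=> k /andP[/andP[_ ki] _]; rewrite ltn_eqF // expr0n.
Qed.

Lemma mxbound_entry A c i j : nonneg_mx A -> mxbound A c -> A i j <= c.
Proof.
move=> A0 Ac.
have := Ac i.+1 j.+1 (fun k => (k == i)%:R) (fun k => (k == j)%:R) (fun=> ler0n _ _) (fun=> ler0n _ _).
rewrite !enorm_delta !mulr1; apply: le_trans.
have h k l : 0 <= (k == i)%:R * A k l * (l == j)%:R by rewrite !mulr_ge0 ?ler0n.
have := ler_sum_term (N := i.+1) (u := fun k => \sum_(0 <= l < j.+1) (k == i)%:R * A k l * (l == j)%:R).
move=> /(_ i (fun k => sumr_ge0 _ (fun l _ => h k l)) (ltnSn i)); apply: le_trans.
have := ler_sum_term (N := j.+1) (h i) (ltnSn j).
by rewrite /= !eqxx mul1r mulr1.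
Qed.

Lemma mxbound_ge0 A c : nonneg_mx A -> mxbound A c -> 0 <= c.
Proof. by move=> A0 Ac; apply: le_trans (mxbound_entry 0 0 A0 Ac). Qed.

Lemma mxbound_le A c d : c <= d -> mxbound A c -> mxbound A d.
Proof.
move=> cd Ac M N y x y0 x0; apply: le_trans (Ac M N y x y0 x0) _.
by rewrite ler_wpM2r // mulr_ge0 ?enorm_ge0.
Qed.

Lemma mxbound_mono A B c : (forall i j, A i j <= B i j) -> mxbound B c -> mxbound A c.
Proof.
move=> AB Bc M N y x y0 x0; apply: le_trans (Bc M N y x y0 x0).
exact: ler_mxform.
Qed.

Lemma mxbound_tr A c : mxbound A c -> mxbound (mxtr A) c.
Proof.
move=> Ac M N y x y0 x0; have := Ac N M x y x0 y0.
rewrite [enorm x N * _]mulrC; congr (_ <= _).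
rewrite /mxform exchange_big /=; apply: eq_bigr => j _; apply: eq_bigr => i _.
by rewrite /mxtr; ring.
Qed.

Lemma mxboundD A B c d : mxbound A c -> mxbound B d ->
  mxbound (fun i j => A i j + B i j) (c + d).
Proof.
move=> Ac Bd M N y x y0 x0; rewrite mulrDl.
apply: le_trans (lerD (Ac M N y x y0 x0) (Bd M N y x y0 x0)).
rewrite /mxform -big_split /=; apply: ler_sum_nat => i _.
rewrite -big_split /=; apply: ler_sum_nat => j _.
by rewrite mulrDr mulrDl.
Qed.

(** The form is tested on y = z, the truncated image itself: |z|^2 <= c |z| |x|, and one factor |z|
    cancels unless it is 0. *)
Lemma mxbound_app A c x M N : nonneg_mx A -> mxbound A c -> (forall j, 0 <= x j) ->
  enorm (fun i => \sum_(0 <= j < N) A i j * x j) M <= c * enorm x N.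
Proof.
move=> A0 Ac x0; set z := fun i => _.
have z0 i : 0 <= z i by apply: sumr_ge0 => j _; rewrite mulr_ge0.
have := Ac M N z x z0 x0; rewrite mxformE.
have -> : \sum_(0 <= i < M) z i * (\sum_(0 <= j < N) A i j * x j) = enorm z M ^+ 2.
  by rewrite sqr_enorm; apply: eq_bigr => i _; rewrite expr2.
have c0 := mxbound_ge0 A0 Ac.
have [->|zn0] := eqVneq (enorm z M) 0; first by rewrite mulr_ge0 ?enorm_ge0.
have zp : 0 < enorm z M by rewrite lt_def zn0 enorm_ge0.
by rewrite mulrCA expr2 ler_pM2l.
Qed.

Lemma mxbound_mul_trunc A B c d K : nonneg_mx A -> nonneg_mx B ->
  mxbound A c -> mxbound B d ->
  mxbound (fun i j => \sum_(0 <= k < K) A i k * B k j) (c * d).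
Proof.
move=> A0 B0 Ac Bd M N y x y0 x0.
set z := fun k => \sum_(0 <= j < N) B k j * x j.
have z0 i : 0 <= z i by apply: sumr_ge0 => j _; rewrite mulr_ge0.
have -> : mxform (fun i j => \sum_(0 <= k < K) A i k * B k j) M N y x = mxform A M K y z.
  apply: eq_bigr => i _.
  transitivity (\sum_(0 <= j < N) \sum_(0 <= k < K) y i * A i k * (B k j * x j)).
    apply: eq_bigr => j _; rewrite mulr_sumr mulr_suml; apply: eq_bigr => k _.
    by rewrite !mulrA.
  by rewrite exchange_big /=; apply: eq_bigr => k _; rewrite /z mulr_sumr.
apply: le_trans (Ac M K y z y0 z0) _.
rewrite -mulrA; apply: ler_wpM2l; first exact: mxbound_ge0 Ac.
rewrite mulrCA; apply: ler_wpM2l; first exact: enorm_ge0.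
exact: mxbound_app.
Qed.

(** Each partial sum is an entry of a product with truncated inner index, and that product has bound
    c d. *)
Lemma mxmul_sums_bounded A B : opmx A -> opmx B ->
  forall i j, sums_bounded (fun k => A i k * B k j).
Proof.
move=> [A0 [c Ac]] [B0 [d Bd]] i j; exists (c * d) => K.
apply: (mxbound_entry (A := fun i j => \sum_(0 <= k < K) A i k * B k j)).
  by move=> p q; apply: sumr_ge0 => k _; rewrite mulr_ge0.
exact: mxbound_mul_trunc.
Qed.

Lemma nonneg_mul A B i j k : nonneg_mx A -> nonneg_mx B -> 0 <= A i k * B k j.
Proof. by move=> A0 B0; rewrite mulr_ge0. Qed.

Lemma nonneg_mxmul A B : nonneg_mx A -> nonneg_mx B -> nonneg_mx (mxmul A B).
Proof. by move=> A0 B0 i j; apply: rsum_ge0 => k; exact: nonneg_mul. Qed.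

(** The bound for truncated inner sums is uniform in K, and a finite form depends continuously on
    its finitely many entries. *)
Lemma mxbound_mul A B c d : nonneg_mx A -> nonneg_mx B ->
  mxbound A c -> mxbound B d -> mxbound (mxmul A B) (c * d).
Proof.
move=> A0 B0 Ac Bd M N y x y0 x0.
have oA : opmx A by split; last exists c.
have oB : opmx B by split; last exists d.
have h : mxform (fun i j => \sum_(0 <= k < K) A i k * B k j) M N y x @[K --> \oo]
   --> mxform (mxmul A B) M N y x.
  apply: cvg_sum_range => i _; apply: cvg_sum_range => j _.
  apply: cvgMl; apply: cvgMr; apply: nonneg_rsum_cvg => [k|]; first exact: nonneg_mul.
  exact: mxmul_sums_bounded.
rewrite -(cvg_lim (@Rhausdorff R) h); apply: limr_le; first exact: cvgP h.
by apply: nearW => K; exact: mxbound_mul_trunc.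
Qed.

Lemma opmx_mul A B : opmx A -> opmx B -> opmx (mxmul A B).
Proof.
move=> [A0 [c Ac]] [B0 [d Bd]]; split; first exact: nonneg_mxmul.
by exists (c * d); exact: mxbound_mul.
Qed.

Lemma opmx_tr A : opmx A -> opmx (mxtr A).
Proof.
by move=> [A0 [c Ac]]; split=> [i j|]; [exact: A0|exists c; exact: mxbound_tr].
Qed.

Lemma opmx_mono A B : nonneg_mx A -> (forall i j, A i j <= B i j) -> opmx B -> opmx A.
Proof.
by move=> A0 AB [B0 [c Bc]]; split => //; exists c; exact: mxbound_mono Bc.
Qed.

Lemma mxtr_mul A B : mxtr (mxmul A B) = mxmul (mxtr B) (mxtr A).
Proof.
apply/funext => i; apply/funext => j; rewrite /mxtr /mxmul; congr rsum.
by apply/funext => k; rewrite mulrC.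
Qed.

Lemma ler_mxmul A A' B B' : nonneg_mx A -> nonneg_mx B -> opmx A' -> opmx B' ->
  (forall i j, A i j <= A' i j) -> (forall i j, B i j <= B' i j) ->
  forall i j, mxmul A B i j <= mxmul A' B' i j.
Proof.
move=> A0 B0 oA oB AA BB i j; apply: ler_rsum; last exact: mxmul_sums_bounded.
by move=> k; rewrite mulr_ge0 //= ler_pM.
Qed.

(** Both sides are iterated sums of the nonnegative terms [f], in the two orders; the finite double
    sums are bounded because the entries of A (B C) converge. *)
Lemma mxmulA A B C : opmx A -> opmx B -> opmx C ->
  mxmul (mxmul A B) C = mxmul A (mxmul B C).
Proof.
move=> oA oB oC; apply/funext => i; apply/funext => j.
pose f k l := A i l * B l k * C k j.
have [A0 _] := oA; have [B0 _] := oB; have [C0 _] := oC.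
have f0 k l : 0 <= f k l by rewrite !mulr_ge0.
have -> : mxmul (mxmul A B) C i j = rsum (fun k => rsum (f k)).
  congr rsum; apply/funext => k; rewrite mulrC -rsumZ; last first.
    by apply: sums_bounded_norm; [move=> l; exact: nonneg_mul|exact: mxmul_sums_bounded].
  by congr rsum; apply/funext => l; rewrite mulrC.
have -> : mxmul A (mxmul B C) i j = rsum (fun l => rsum (f^~ l)).
  congr rsum; apply/funext => l; rewrite -rsumZ; last first.
    by apply: sums_bounded_norm; [move=> k; exact: nonneg_mul|exact: mxmul_sums_bounded].
  by congr rsum; apply/funext => k; rewrite mulrA.
have [c hc] : exists c, forall L K, \sum_(0 <= l < L) \sum_(0 <= k < K) f k l <= c.
  have [c hc] := mxmul_sums_bounded oA (opmx_mul oB oC) i j.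
  exists c => L K; apply: le_trans (hc L); apply: ler_sum_nat => l _.
  rewrite /f; under eq_bigr do rewrite -mulrA.
  rewrite -mulr_sumr ler_wpM2l //; apply: (sum_le_rsum (u := fun k => B l k * C k j)).
    by move=> k; exact: nonneg_mul.
  exact: mxmul_sums_bounded.
apply: le_anti; apply/andP; split.
  by apply: (rsum_exchange (c := c)) => // M N; rewrite exchange_big; exact: hc.
exact: (rsum_exchange (c := c)).
Qed.

Lemma rsum_delta (u : nat -> R) i : rsum (fun k => (i == k)%:R * u k) = u i.
Proof.
rewrite (@rsum_finite _ _ i.+1) => [|k ik]; last by rewrite ltn_eqF // mul0r.
rewrite big_nat_recr //= eqxx mul1r big_nat_cond big1 ?add0r //.
by move=> k /andP[/andP[_ ki] _]; rewrite gtn_eqF // mul0r.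
Qed.

Lemma mxmul1l A : mxmul (@idmx R) A = A.
Proof. by apply/funext => i; apply/funext => j; rewrite /mxmul rsum_delta. Qed.

Lemma mxmul1r A : mxmul A (@idmx R) = A.
Proof.
apply/funext => i; apply/funext => j; rewrite -[RHS](rsum_delta (A i) j).
by congr rsum; apply/funext => k; rewrite mulrC eq_sym.
Qed.

Lemma opmx1 : opmx (@idmx R).
Proof.
split=> [i j|]; first exact: ler0n.
exists 1 => M N y x y0 x0; rewrite mul1r.
(* The form is rectangular, so [w] marks the indices below both M and N; summing up to [maxn M N]
   and cutting at [minn M N] treats M <= N and N <= M together. *)
pose w i : R := y i * x i * ((i < M)%N && (i < N)%N)%:R.
rewrite mxformE; apply: (@le_trans _ _ (\sum_(0 <= i < maxn M N) w i)).
  have -> : \sum_(0 <= i < M) y i * (\sum_(0 <= j < N) idmx R i j * x j) =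
    \sum_(0 <= i < M) w i.
    apply: eq_big_nat => i /andP[_ iM]; rewrite /w iM /= -mulrA; congr (_ * _).
    have [iN|Ni] := ltnP i N; last first.
      rewrite mulr0 big_nat_cond big1 // => k /andP[/andP[_ kN] _].
      by rewrite /idmx gtn_eqF ?mul0r //; exact: leq_trans Ni.
    rewrite mulr1 -(@rsum_delta x i) (@rsum_finite _ _ N) // => k Nk.
    by rewrite ltn_eqF ?mul0r //; exact: leq_trans Nk.
  by apply: ler_sum_range; rewrite ?leq_maxl // => k; rewrite /w !mulr_ge0.
apply: (@le_trans _ _ (\sum_(0 <= i < minn M N) y i * x i)).
  rewrite (big_cat_nat (leq0n (minn M N))) /=; last by rewrite geq_min leq_maxl.
  rewrite [X in _ + X]big_nat_cond [X in _ + X]big1 ?addr0.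
    by apply: ler_sum_nat => i /andP[_]; rewrite /w leq_min => ->; rewrite mulr1.
  by move=> k /andP[/andP[mk _] _]; rewrite /w -leq_min ltnNge mk mulr0.
apply: le_trans (cauchy_schwarz_enorm _ _ _) _.
by apply: ler_pM; rewrite ?enorm_ge0 ?enorm_range ?geq_minl ?geq_minr.
Qed.

Lemma opmx_pow A m : opmx A -> opmx (mxpow A m).
Proof. by move=> oA; elim: m => [|m IH] /=; [exact: opmx1|exact: opmx_mul]. Qed.

Lemma mxpowD A m n : opmx A -> mxpow A (m + n) = mxmul (mxpow A m) (mxpow A n).
Proof.
move=> oA; elim: m => [|m IH]; first by rewrite add0n mxmul1l.
by rewrite addSn /= IH mxmulA //; exact: opmx_pow.
Qed.

Lemma mxpow_double A m : opmx A -> mxpow (mxmul A A) m = mxpow A (m + m).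
Proof.
move=> oA; elim: m => [//|m IH]; rewrite /= IH addnS /= mxmulA //; exact: opmx_pow.
Qed.

Definition hadamard s t A B : mx R := hmul (hpow A s) (hpow B t).

Lemma nonneg_hadamard s t A B : nonneg_mx (hadamard s t A B).
Proof. by move=> i j; rewrite mulr_ge0 ?powR_ge0. Qed.

(** Every entry a is at most c, so a^t = a a^(t-1) <= c^(t-1) a and the Hadamard power is dominated
    by a multiple of A. *)
Lemma mxbound_hpow A c t : nonneg_mx A -> mxbound A c -> 1 <= t ->
  mxbound (hpow A t) (c `^ t).
Proof.
move=> A0 Ac t1 M N y x y0 x0; have c0 := mxbound_ge0 A0 Ac.
have tp : 0 < t by lra.
apply: (@le_trans _ _ (c `^ (t - 1) * mxform A M N y x)); last first.
  by rewrite -(mulr_powRB1 c0 tp) [c * _]mulrC -mulrA ler_wpM2l ?powR_ge0 ?Ac.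
rewrite mulr_sumr; apply: ler_sum_nat => i _; rewrite mulr_sumr; apply: ler_sum_nat => j _.
rewrite /hpow -mulr_powRB1 //.
have -> : y i * (A i j * A i j `^ (t - 1)) * x j = A i j `^ (t - 1) * (y i * A i j * x j) by ring.
rewrite ler_wpM2r ?mulr_ge0 //.
by apply: le_powR => //; [lra|exact: mxbound_entry].
Qed.

Lemma mxbound_hadamard1 A B c d s t : nonneg_mx A -> nonneg_mx B ->
  mxbound A c -> mxbound B d -> 0 <= s -> 0 <= t -> s + t = 1 ->
  mxbound (hadamard s t A B) (c `^ s * d `^ t).
Proof.
move=> A0 B0 Ac Bd s0 t0 st M N y x y0 x0.
have c0 := mxbound_ge0 A0 Ac; have d0 := mxbound_ge0 B0 Bd.
(* Writing y_i and x_j as products of their s-th and t-th powers turns each term into (y_i a_ij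
   x_j)^s (y_i b_ij x_j)^t, ready for Hoelder in j and then in i. *)
have p1 a : 0 <= a -> a = a `^ s * a `^ t by move=> a0; rewrite -powR_addM // st powRr1.
have yA i j : 0 <= y i * A i j * x j by rewrite !mulr_ge0.
have yB i j : 0 <= y i * B i j * x j by rewrite !mulr_ge0.
apply: (@le_trans _ _ (mxform A M N y x `^ s * mxform B M N y x `^ t)).
  apply: le_trans (hoelder_sum1 _ _ _ s0 t0 st); last 2 first.
  - by move=> i; apply: sumr_ge0.
  - by move=> i; apply: sumr_ge0.
  apply: ler_sum_nat => i _; apply: le_trans (hoelder_sum1 _ _ _ s0 t0 st) => //.
  apply: ler_sum_nat => j _.
  rewrite {1}(p1 (y i)) // {1}(p1 (x j)) // /hadamard /hmul /hpow.
  rewrite !powRM ?mulr_ge0 // le_eqVlt; apply/orP; left; apply/eqP; ring.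
move n_def : (enorm y M * enorm x N) => n.
have n0 : 0 <= n by rewrite -n_def mulr_ge0 ?enorm_ge0.
have -> : c `^ s * d `^ t * n = (c * n) `^ s * (d * n) `^ t.
  by rewrite {1}(p1 n) // !powRM //; ring.
by apply: ler_pM; rewrite ?powR_ge0 //; apply: le_powR => //; rewrite -?n_def ?Ac ?Bd //;
  apply: sumr_ge0 => i _; apply: sumr_ge0.
Qed.

Lemma mxbound_hadamard A B c d s t : nonneg_mx A -> nonneg_mx B ->
  mxbound A c -> mxbound B d -> 0 <= s -> 0 <= t -> 1 <= s + t ->
  mxbound (hadamard s t A B) (c `^ s * d `^ t).
Proof.
move=> A0 B0 Ac Bd s0 t0 st; have stp : 0 < s + t by lra.
rewrite -powR_mul_div ?(mxbound_ge0 A0 Ac) ?(mxbound_ge0 B0 Bd) //.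
have -> : hadamard s t A B = hpow (hadamard (s / (s + t)) (t / (s + t)) A B) (s + t).
  apply/funext => i; apply/funext => j.
  by rewrite /hadamard /hmul /hpow powR_mul_div.
apply: mxbound_hpow => //; first exact: nonneg_hadamard.
by apply: mxbound_hadamard1; rewrite ?divr_ge0 ?(ltW stp) // -mulrDl divff // lt0r_neq0.
Qed.

Lemma opmx_hadamard A B s t : opmx A -> opmx B ->
  0 <= s -> 0 <= t -> 1 <= s + t -> opmx (hadamard s t A B).
Proof.
move=> [A0 [c Ac]] [B0 [d Bd]] s0 t0 st; split; first exact: nonneg_hadamard.
by exists (c `^ s * d `^ t); exact: mxbound_hadamard.
Qed.

Lemma hadamard_mul_le A A' B B' s t : opmx A -> opmx A' -> opmx B -> opmx B' ->
  0 <= s -> 0 <= t -> 1 <= s + t -> forall i j,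
  mxmul (hadamard s t A B) (hadamard s t A' B') i j <=
  hadamard s t (mxmul A A') (mxmul B B') i j.
Proof.
move=> oA oA' oB oB' s0 t0 st i j.
have [A0 _] := oA; have [A0' _] := oA'; have [B0 _] := oB; have [B0' _] := oB'.
apply: rsum_le => [k|N]; first by rewrite mulr_ge0 ?nonneg_hadamard.
have := hoelder_rsum (fun k => nonneg_mul i j k A0 A0') (fun k => nonneg_mul i j k B0 B0')
  (mxmul_sums_bounded oA oA' i j) (mxmul_sums_bounded oB oB' i j) s0 t0 st N.
apply: le_trans; apply: ler_sum_nat => k _.
by rewrite /hadamard /hmul /hpow !powRM // mulrACA.
Qed.

End Forms.

(** * The limit of the norms of the row tails *)

Section Tau.
Variable R : realType.
Implicit Types (A B C : mx R) (x y u : nat -> R) (c d e s t : R).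

Definition tail n A : mx R := fun i j => if (n <= i)%N then A i j else 0.

(** Bounds for [tail n A] persist for larger n, so this infimum over all n is the limit of the tail
    norms. *)
Definition tau A : R := inf [set c | exists n, mxbound (tail n A) c].

Lemma nonneg_tail n A : nonneg_mx A -> nonneg_mx (tail n A).
Proof. by move=> A0 i j; rewrite /tail; case: ifP. Qed.

Lemma tail_le n A : nonneg_mx A -> forall i j, tail n A i j <= A i j.
Proof. by move=> A0 i j; rewrite /tail; case: ifP. Qed.

Lemma opmx_tail n A : opmx A -> opmx (tail n A).
Proof.
move=> oA; have [A0 _] := oA; apply: opmx_mono oA; [exact: nonneg_tail|exact: tail_le].
Qed.

Lemma mxbound_tail A c m n : nonneg_mx A -> (m <= n)%N ->
  mxbound (tail m A) c -> mxbound (tail n A) c.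
Proof.
move=> A0 mn; apply: mxbound_mono => i j; rewrite /tail.
case: leqP => // ni; first by rewrite (leq_trans mn).
by case: ifP.
Qed.

Lemma tau_le A c n : nonneg_mx A -> mxbound (tail n A) c -> tau A <= c.
Proof.
move=> A0 h; apply: ge_inf; last by exists n.
by exists 0 => d [m /mxbound_ge0]; apply; exact: nonneg_tail.
Qed.

Lemma tau_le_bound A c : nonneg_mx A -> mxbound A c -> tau A <= c.
Proof.
by move=> A0 h; apply: (@tau_le _ _ 0) => //; apply: mxbound_mono h; exact: tail_le.
Qed.

Lemma tau_set_neq0 A : opmx A -> [set c | exists n, mxbound (tail n A) c] !=set0.
Proof.
by move=> [A0 [c Ac]]; exists c; exists 0%N; apply: mxbound_mono Ac; exact: tail_le.
Qed.

Lemma tau_ge0 A : opmx A -> 0 <= tau A.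
Proof.
move=> oA; apply: lb_le_inf; first exact: tau_set_neq0.
by move=> d [m /mxbound_ge0]; apply; apply: nonneg_tail; case: oA.
Qed.

Lemma tau_lt A c : opmx A -> tau A < c -> exists n, mxbound (tail n A) c.
Proof.
move=> oA; move=> /(inf_lt (tau_set_neq0 oA))[d [n nd] dc].
by exists n; apply: mxbound_le nd; exact: ltW.
Qed.

Lemma tau_near A e : opmx A -> 0 < e -> exists n, mxbound (tail n A) (tau A + e).
Proof. by move=> oA e0; apply: tau_lt => //; rewrite ltrDl. Qed.

Lemma tau_mono A B : nonneg_mx A -> (forall i j, A i j <= B i j) -> opmx B ->
  tau A <= tau B.
Proof.
move=> A0 AB oB; apply/ler_addgt0Pr => e e0.
have [n nB] := tau_near oB e0; apply: (@tau_le _ _ n) => //.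
by apply: mxbound_mono nB => i j; rewrite /tail; case: ifP.
Qed.

(** Lets e tend to 0 along [harmonic] in estimates where e enters through products or powers. *)
Lemma le_cvg_harmonic (f : R -> R) c d :
  (forall e, 0 < e -> c <= f e) -> f (harmonic n) @[n --> \oo] --> d -> c <= d.
Proof.
move=> fc fd; rewrite -(cvg_lim (@Rhausdorff R) fd); apply: limr_ge; first exact: cvgP fd.
by apply: nearW => n; apply: fc; exact: harmonic_gt0.
Qed.

Lemma cvg_add_harmonic c : c + harmonic n @[n --> \oo] --> c.
Proof. by rewrite -[X in _ --> X]addr0; apply: cvgD; [exact: cvg_cst|exact: cvg_harmonic]. Qed.

Lemma tau_hadamard A B s t : opmx A -> opmx B -> 0 <= s -> 0 <= t -> 1 <= s + t ->
  tau (hadamard s t A B) <= tau A `^ s * tau B `^ t.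
Proof.
move=> oA oB s0 t0 st; have [A0 _] := oA; have [B0 _] := oB.
apply: (@le_cvg_harmonic (fun e => (tau A + e) `^ s * (tau B + e) `^ t)) => [e e0|].
  have [n nA] := tau_near oA e0; have [m mB] := tau_near oB e0.
  have nA' := mxbound_tail A0 (leq_maxl n m) nA.
  have mB' := mxbound_tail B0 (leq_maxr n m) mB.
  apply: (@tau_le _ _ (maxn n m)); first exact: nonneg_hadamard.
  have := mxbound_hadamard (nonneg_tail _ A0) (nonneg_tail _ B0) nA' mB' s0 t0 st.
  apply: mxbound_mono => i j; rewrite /tail; case: ifP => ij.
    by rewrite /hadamard /hmul /hpow ij.
  exact: nonneg_hadamard.
by apply: cvgM; apply: cvg_powR => //; first [exact: cvg_add_harmonic|
  move=> n; rewrite addr_ge0 ?tau_ge0 ?harmonic_ge0].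
Qed.

Lemma tail_sum_small u e : (forall k, 0 <= u k) -> sums_bounded u -> 0 < e ->
  exists m, forall N, \sum_(0 <= k < N) (if (m <= k)%N then u k else 0) <= e.
Proof.
move=> u0 su e0; have /cvgrPdist_le /(_ e e0) [m _ hm] := nonneg_rsum_cvg u0 su.
exists m => N; have := hm m (leqnn m) => /(le_trans (ler_norm _)).
apply: le_trans; rewrite lerBrDr.
apply: le_trans (sum_le_rsum u0 su (m + N)); rewrite addrC.
have mN : (m <= m + N)%N by exact: leq_addr.
rewrite [leRHS](big_cat_nat (leq0n m) mN) /= lerD2l.
apply: (@le_trans _ _ (\sum_(0 <= k < m + N) (if (m <= k)%N then u k else 0))).
  by apply: ler_sum_range (leq_addl _ _) => k; case: ifP.
rewrite (big_cat_nat (leq0n m) mN) /= [X in X + _]big_nat_cond [X in X + _]big1 ?add0r.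
  by apply: ler_sum_nat => k /andP[->].
by move=> k /andP[/andP[_ km] _]; rewrite leqNgt km.
Qed.

Lemma mxbound_row u i0 e : (forall N, enorm u N <= e) ->
  mxbound (fun i j => if i == i0 then u j else 0) e.
Proof.
move=> ue M N y x y0 x0; rewrite mxformE.
have e0 : 0 <= e by apply: le_trans (ue 0%N); exact: enorm_ge0.
have [iM|Mi] := ltnP i0 M; last first.
  rewrite big_nat_cond big1 ?mulr_ge0 ?enorm_ge0 // => i /andP[/andP[_ iM] _].
  have ii : (i < i0)%N by exact: leq_trans Mi.
  by rewrite /= (ltn_eqF ii) big1 ?mulr0 // => j _; exact: mul0r.
rewrite (big_cat_nat (leq0n i0) (ltnW iM)) /= big_nat_cond big1 ?add0r; last first.
  move=> i /andP[/andP[_ ii] _].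
  by rewrite /= (ltn_eqF ii) big1 ?mulr0 // => j _; exact: mul0r.
rewrite big_ltn //= eqxx [X in _ + X]big_nat_cond [X in _ + X]big1 ?addr0; last first.
  move=> i /andP[/andP[ii _] _].
  by rewrite /= (gtn_eqF ii) big1 ?mulr0 // => j _; exact: mul0r.
apply: (@le_trans _ _ (y i0 * (e * enorm x N))).
  rewrite ler_wpM2l //; apply: le_trans (cauchy_schwarz_enorm _ _ _) _.
  by rewrite ler_wpM2r ?enorm_ge0.
rewrite mulrCA ler_wpM2l // ler_wpM2r ?enorm_ge0 //.
by rewrite -[y i0]ger0_norm //; exact: enorm_term.
Qed.

(** The sum of squares along row i is the (i, i) entry of A times its transpose. *)
Lemma row_sums_bounded A i : opmx A -> sums_bounded (fun j => A i j ^+ 2).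
Proof.
move=> oA; have := mxmul_sums_bounded oA (opmx_tr oA) i i.
by move=> [c h]; exists c => N; apply: le_trans (h N); apply: ler_sum_nat => k _; rewrite expr2.
Qed.

(** Each row lies in l2, hence is small in far columns. The induction spends half of e on the first
    n rows and half on row n. *)
Lemma finite_rows_small A n e : opmx A -> 0 < e ->
  exists m, mxbound (fun i j => if (i < n)%N && (m <= j)%N then A i j else 0) e.
Proof.
move=> oA; have [A0 _] := oA; elim: n e => [|n IH] e e0.
  exists 0%N => M N y x y0 x0; rewrite /mxform big1 ?mulr_ge0 ?enorm_ge0 ?ltW // => i _.
  by apply: big1 => j _; rewrite ltn0 mulr0 mul0r.
have e2 : 0 < e / 2 by rewrite divr_gt0.
have [m1 h1] := IH _ e2.
have [m2 h2] := tail_sum_small (fun k => sqr_ge0 (A n k)) (row_sums_bounded n oA)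
  (exprn_gt0 2 e2).
exists (maxn m1 m2).
have h3 : mxbound (fun i j => if i == n then (if (m2 <= j)%N then A n j else 0) else 0) (e / 2).
  apply: (@mxbound_row (fun j => if (m2 <= j)%N then A n j else 0)) => N.
  apply: enorm_le; first exact: ltW.
  apply: le_trans (h2 N); apply: ler_sum_nat => k _; case: ifP => // _.
  by rewrite expr0n.
rewrite [e]splitr; apply: mxbound_mono (mxboundD h1 h3) => i j.
rewrite geq_max ltnS.
by case: (ltngtP i n) => [_|_|->]; case: (leqP m1 j) => _; case: (leqP m2 j) => _;
  rewrite /= ?addr0 ?add0r.
Qed.

(** The far columns of A split into rows from n on, of norm at most tau A + e/2, and the first n
    rows, small in far columns. The transpose of that sum dominates the far rows of [mxtr A]. *)
Lemma tau_tr_le A : opmx A -> tau (mxtr A) <= tau A.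
Proof.
move=> oA; have [A0 _] := oA; apply/ler_addgt0Pr => e e0.
have e2 : 0 < e / 2 by rewrite divr_gt0.
have [n nA] := tau_near oA e2; have [m h] := finite_rows_small n oA e2.
apply: (@tau_le _ _ m); first by move=> i j; exact: A0.
have := mxbound_tr (mxboundD nA h); rewrite -addrA -splitr.
apply: mxbound_mono => i j; rewrite /tail /mxtr /=.
by case: leqP => mi; rewrite ?andbT ?andbF /=; case: leqP => _; rewrite ?addr0 ?add0r.
Qed.

Lemma tau_tr A : opmx A -> tau (mxtr A) = tau A.
Proof.
move=> oA; apply: le_anti; rewrite tau_tr_le //=.
exact: (tau_tr_le (opmx_tr oA)).
Qed.

(** The inner index is cut at m. Indices k >= m meet only [tail m B], which gives (tau A + e)(tau B
    + e). Indices k < m meet the first m columns of A, whose far rows (the matrix [Y]) have norm at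
    most e, which gives e c. *)
Lemma tau_mul A B : opmx A -> opmx B -> tau (mxmul A B) <= tau A * tau B.
Proof.
move=> oA oB; have [A0 _] := oA; have [B0 [c Bc]] := oB.
apply: (@le_cvg_harmonic (fun e => (tau A + e) * (tau B + e) + e * c)) => [e e0|]; last first.
  rewrite -[X in _ --> X]addr0; apply: cvgD.
    by apply: cvgM; exact: cvg_add_harmonic.
  by rewrite -[X in _ --> X](mul0r c); apply: cvgMl; exact: cvg_harmonic.
have [n nA] := tau_near oA e0; have [m mB] := tau_near oB e0.
have [p h] := finite_rows_small m (opmx_tr oA) e0.
set Y := mxtr (fun i j => if (i < m)%N && (p <= j)%N then mxtr A i j else 0).
have Ye : mxbound Y e by exact: mxbound_tr h.
have Y0 : nonneg_mx Y by move=> i j; rewrite /Y /mxtr; case: ifP.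
have oY : opmx Y by split => //; exists e.
apply: (@tau_le _ _ (maxn n p)); first exact: nonneg_mxmul.
have := mxboundD (mxbound_mul (nonneg_tail n A0) (nonneg_tail m B0) nA mB)
  (mxbound_mul Y0 B0 Ye Bc).
have oX := opmx_tail n oA; have oZ := opmx_tail m oB.
apply: mxbound_mono => i j; rewrite {1}/tail; case: ifP => ij; last first.
  by apply: addr_ge0; apply: nonneg_mxmul => //; exact: nonneg_tail.
move: ij; rewrite geq_max => /andP[ni pi].
have s1 := sums_bounded_norm (fun k => nonneg_mul i j k (nonneg_tail n A0) (nonneg_tail m B0))
  (mxmul_sums_bounded oX oZ i j).
have s2 := sums_bounded_norm (fun k => nonneg_mul i j k Y0 B0) (mxmul_sums_bounded oY oB i j).
rewrite -[leRHS]rsumD // le_eqVlt; apply/orP; left; apply/eqP.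
congr rsum; apply/funext => k; rewrite /tail ni /Y /mxtr pi andbT.
by case: ltnP => _; rewrite ?mulr0 ?mul0r ?addr0 ?add0r.
Qed.

End Tau.

(** * Real suprema and their default value *)

Section Sup.
Variable R : realType.
Implicit Type E : set R.

(** On a set that is empty or unbounded above, [sup] takes the default value 0, which is still
    nonnegative. *)
Lemma sup_nonneg E : (forall x, E x -> 0 <= x) -> 0 <= sup E.
Proof.
move=> E0; have [[[x Ex] Eu]|nE] := pselect (has_sup E); last by rewrite sup_out.
by apply: le_trans (E0 _ Ex) _; exact: ub_le_sup.
Qed.

(* [sup] of the empty set is 0. *)
Lemma sup_le_nonneg E c : 0 <= c -> (forall x, E x -> x <= c) -> sup E <= c.
Proof.
move=> c0 Ec; have [->|/set0P E0] := eqVneq E set0; first by rewrite sup0.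
by apply: ge_sup => // x; exact: Ec.
Qed.

End Sup.

(** * The space l2, and boundedness of nonnegative matrix operators on it *)

Section EllTwo.
Variable R : realType.
Implicit Types (A B C : mx R) (x y u : nat -> R) (c d e s t : R).

Lemma nneseries_rsum u : (forall k, 0 <= u k) -> sums_bounded u ->
  (\sum_(0 <= k <oo) (u k)%:E = (rsum u)%:E)%E.
Proof.
move=> u0 su; rewrite /rsum -EFin_lim; last exact: cvgP (nonneg_rsum_cvg u0 su).
by congr (limn _); apply/funext => n /=; rewrite sumEFin.
Qed.

Lemma nneseries_ltyP u : (forall k, 0 <= u k) ->
  ((\sum_(0 <= k <oo) (u k)%:E < +oo)%E <-> sums_bounded u).
Proof.
move=> u0; split=> [h|su]; last by rewrite nneseries_rsum // ltry.
have h0 : (0 <= \sum_(0 <= k <oo) (u k)%:E)%E.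
  by apply: nneseries_ge0 => k _ _; rewrite lee_fin.
exists (fine (\sum_(0 <= k <oo) (u k)%:E)%E) => N.
rewrite -lee_fin fineK ?ge0_fin_numE // -sumEFin.
by apply: nneseries_lim_ge => k _; rewrite lee_fin.
Qed.

Lemma l2P x : l2 x <-> sums_bounded (fun k => x k ^+ 2).
Proof. by apply: nneseries_ltyP => k; exact: sqr_ge0. Qed.

Lemma l2normE x : l2 x -> l2norm x = Num.sqrt (rsum (fun k => x k ^+ 2)).
Proof.
by move=> /l2P lx; rewrite /l2norm nneseries_rsum // => k; exact: sqr_ge0.
Qed.

Lemma l2norm_ge0 x : 0 <= l2norm x. Proof. exact: sqrtr_ge0. Qed.

Lemma enorm_l2 x c : (forall N, enorm x N <= c) -> l2 x.
Proof.
move=> h; apply/l2P; exists (c ^+ 2) => N; rewrite -sqr_enorm.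
by rewrite lerXn2r ?nnegrE ?enorm_ge0 //; apply: le_trans (h 0%N); exact: enorm_ge0.
Qed.

Lemma l2norm_le x c : (forall N, enorm x N <= c) -> l2norm x <= c.
Proof.
move=> h; have c0 : 0 <= c by apply: le_trans (h 0%N); exact: enorm_ge0.
rewrite l2normE; last exact: enorm_l2 h.
rewrite -(ger0_norm c0) -sqrtr_sqr; apply: ler_wsqrtr.
apply: rsum_le => [k|N]; first exact: sqr_ge0.
by rewrite -sqr_enorm lerXn2r ?nnegrE ?enorm_ge0.
Qed.

Lemma enorm_le_l2norm x N : l2 x -> enorm x N <= l2norm x.
Proof.
move=> lx; rewrite l2normE //; apply: ler_wsqrtr; apply: sum_le_rsum.
  by move=> k; exact: sqr_ge0.
exact/l2P.
Qed.

Lemma l2_lin x y c : l2 x -> l2 y -> l2 (fun k => c * x k + y k).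
Proof.
move=> lx ly; apply: (@enorm_l2 _ (`|c| * l2norm x + l2norm y)) => N.
apply: le_trans (enormD _ _ _) _; rewrite enormZ.
by apply: lerD; [apply: ler_wpM2l|]; rewrite ?enorm_le_l2norm.
Qed.

Lemma l2_sub x y : l2 x -> l2 y -> l2 (x - y).
Proof.
move=> lx ly; have := l2_lin (-1) ly lx; congr l2; apply/funext => k.
by rewrite fctE mulN1r addrC.
Qed.

Lemma l2norm_sub_le x y : l2 x -> l2 y -> l2norm x <= l2norm (x - y) + l2norm y.
Proof.
move=> lx ly; apply: l2norm_le => N.
have lxy := l2_sub lx ly.
apply: le_trans (lerD (enorm_le_l2norm N lxy) (enorm_le_l2norm N ly)).
apply: le_trans (enormD _ _ _).
by apply: ler_enorm => k _; rewrite fctE subrK.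
Qed.

Lemma mxapp_sums_bounded A x i : opmx A -> l2 x -> sums_bounded (fun j => `|A i j * x j|).
Proof.
move=> [A0 [c Ac]] lx; exists (c * l2norm x) => N.
have h := mxbound_app i.+1 N A0 Ac (fun j => normr_ge0 (x j)).
have -> : \sum_(0 <= j < N) `|A i j * x j| = \sum_(0 <= j < N) A i j * `|x j|.
  by apply: eq_bigr => j _; rewrite normrM ger0_norm.
apply: le_trans (ler_norm _) _.
apply: le_trans (enorm_term (fun i => \sum_(0 <= j < N) A i j * `|x j|) (ltnSn i)) _.
apply: le_trans h _; rewrite ler_wpM2l ?(mxbound_ge0 A0 Ac) //.
apply: le_trans (enorm_le_l2norm N lx); apply: ler_enorm => k _.
by rewrite normr_id.
Qed.

(** Signs are removed by |A x| <= A |x| in each coordinate; the bound for truncated sums over j then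
    passes to the limit in finitely many coordinates. *)
Lemma enorm_mxapp A c x M : nonneg_mx A -> mxbound A c -> l2 x ->
  enorm (mxapp A x) M <= c * l2norm x.
Proof.
move=> A0 Ac lx; have oA : opmx A by split; last exists c.
have c0 := mxbound_ge0 A0 Ac.
have nE i j : `|A i j * x j| = A i j * `|x j| by rewrite normrM ger0_norm.
have sA i : sums_bounded (fun j => A i j * `|x j|).
  have := mxapp_sums_bounded i oA lx; congr sums_bounded; apply/funext => j.
  exact: nE.
have p0 i j : 0 <= A i j * `|x j| by rewrite mulr_ge0.
apply: (@le_trans _ _ (enorm (fun i => rsum (fun j => A i j * `|x j|)) M)).
  apply: ler_enorm => i _; rewrite [leRHS]ger0_norm ?rsum_ge0 //.
  apply: le_trans (ler_norm_rsum (mxapp_sums_bounded i oA lx)) _.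
  by under eq_fun do rewrite nE.
apply: enorm_le; first by rewrite mulr_ge0 ?l2norm_ge0.
have h : \sum_(0 <= i < M) (\sum_(0 <= j < N) A i j * `|x j|) ^+ 2 @[N --> \oo] -->
  \sum_(0 <= i < M) rsum (fun j => A i j * `|x j|) ^+ 2.
  apply: (@cvg_sum_range _ (fun i N => (\sum_(0 <= j < N) A i j * `|x j|) ^+ 2)) => i _.
  under eq_fun do rewrite expr2.
  by rewrite expr2; apply: cvgM; exact: nonneg_rsum_cvg.
rewrite -(cvg_lim (@Rhausdorff R) h); apply: limr_le; first exact: cvgP h.
apply: nearW => N; rewrite -sqr_enorm lerXn2r ?nnegrE ?enorm_ge0 ?mulr_ge0 ?l2norm_ge0 //.
apply: le_trans (mxbound_app M N A0 Ac (fun j => normr_ge0 (x j))) _.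
rewrite ler_wpM2l //; apply: le_trans (enorm_le_l2norm N lx); apply: ler_enorm => k _.
by rewrite normr_id.
Qed.

Lemma mxapp_l2 A x : opmx A -> l2 x -> l2 (mxapp A x).
Proof.
by move=> [A0 [c Ac]] lx; apply: enorm_l2 => N; exact: enorm_mxapp Ac lx.
Qed.

Lemma l2norm_mxapp A c x : nonneg_mx A -> mxbound A c -> l2 x ->
  l2norm (mxapp A x) <= c * l2norm x.
Proof. by move=> A0 Ac lx; apply: l2norm_le => N; exact: enorm_mxapp. Qed.

Lemma enorm_eq0 x N : enorm x N = 0 -> forall k, (k < N)%N -> x k = 0.
Proof.
by move=> h k kN; apply/eqP; rewrite -normr_le0 -h; exact: enorm_term.
Qed.

Definition restrict N x : nat -> R := fun j => if (j < N)%N then x j else 0.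

Lemma enorm_restrict N x M : enorm (restrict N x) M <= enorm x N.
Proof.
apply: ler_wsqrtr; have [MN|/ltnW NM] := leqP M N.
  apply: (@le_trans _ _ (\sum_(0 <= k < M) x k ^+ 2)).
    by apply: ler_sum_nat => k /andP[_ kM]; rewrite /restrict (leq_trans kM).
  by apply: ler_sum_range => // k; exact: sqr_ge0.
rewrite (big_cat_nat (leq0n N) NM) /= [X in _ + X]big_nat_cond [X in _ + X]big1 ?addr0.
  by apply: ler_sum_nat => k /andP[_ kN]; rewrite /restrict kN.
by move=> k /andP[/andP[Nk _] _]; rewrite /restrict ltnNge Nk expr0n.
Qed.

(** Converse of [l2norm_mxapp]. The bound is asked only on the unit ball, as [opnorm] supplies it,
    so the test vector is cut to N coordinates and normalised. *)
Lemma mxbound_of_mxapp A c : nonneg_mx A -> 0 <= c ->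
  (forall x, l2 x -> l2norm x <= 1 -> l2 (mxapp A x) /\ l2norm (mxapp A x) <= c) ->
  mxbound A c.
Proof.
move=> A0 c0 h M N y x y0 x0; rewrite mxformE.
have [x00|xn0] := eqVneq (enorm x N) 0.
  rewrite x00 !mulr0 big1 // => i _; rewrite big_nat_cond big1 ?mulr0 // => j.
  by move=> /andP[/andP[_ jN] _]; rewrite (enorm_eq0 x00) // mulr0.
have a0 : 0 < enorm x N by rewrite lt_def xn0 enorm_ge0.
pose z := restrict N (fun j => (enorm x N)^-1 * x j).
have z1 K : enorm z K <= 1.
  apply: le_trans (enorm_restrict _ _ _) _; rewrite enormZ.
  by rewrite ger0_norm ?invr_ge0 ?enorm_ge0 // mulVf.
have [lz nz] := h z (enorm_l2 z1) (l2norm_le z1).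
have zE i : mxapp A z i = (enorm x N)^-1 * \sum_(0 <= j < N) A i j * x j.
  rewrite /mxapp (@rsum_finite _ _ N); last first.
    by move=> k Nk; rewrite /z /restrict ltnNge Nk mulr0.
  rewrite mulr_sumr; apply: eq_big_nat => j /andP[_ jN].
  by rewrite /z /restrict jN mulrCA.
have -> : \sum_(0 <= i < M) y i * (\sum_(0 <= j < N) A i j * x j) =
  enorm x N * \sum_(0 <= i < M) y i * mxapp A z i.
  rewrite mulr_sumr; apply: eq_bigr => i _; rewrite zE.
  by rewrite [RHS]mulrCA; congr (_ * _); rewrite mulrA divff // mul1r.
rewrite mulrA mulrC ler_wpM2r ?enorm_ge0 //.
apply: le_trans (cauchy_schwarz_enorm _ _ _) _; rewrite mulrC ler_wpM2r ?enorm_ge0 //.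
exact: le_trans (enorm_le_l2norm M lz) nz.
Qed.

Lemma sum_half_le2 N : \sum_(0 <= n < N) (2^-1 : R) ^+ n <= 2.
Proof.
suff -> : \sum_(0 <= n < N) (2^-1 : R) ^+ n = 2 - 2 * 2^-1 ^+ N.
  by rewrite gerBl mulr_ge0 // exprn_ge0 // invr_ge0.
elim: N => [|N IH]; first by rewrite big_geq // expr0 mulr1 subrr.
rewrite big_nat_recr //= IH exprS; lra.
Qed.

(* Gliding hump: were A unbounded, unit vectors z_n with |A z_n| > 4^n would be
   dominated by 2^n X for a single X in l2, so that |A X| > 2^n for every n. *)
Lemma defines_operator_bounded A : nonneg_mx A -> defines_operator A ->
  exists c, mxbound A c.
Proof.
move=> A0 dA; apply: contrapT => nb.
have hump n : exists t : (nat * nat) * ((nat -> R) * (nat -> R)),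
  [/\ forall i, 0 <= t.2.1 i, forall j, 0 <= t.2.2 j &
    4 ^+ n * (enorm t.2.1 t.1.1 * enorm t.2.2 t.1.2) <
      mxform A t.1.1 t.1.2 t.2.1 t.2.2].
  apply: contrapT => h; apply: nb; exists (4 ^+ n) => M N y x y0 x0.
  rewrite leNgt; apply/negP => lt; apply: h.
  by exists ((M, N), (y, x)); split.
have [f hf] := choice hump.
pose N n := (f n).1.2; pose x n := (f n).2.2.
pose a n := enorm (x n) (N n).
have a_gt0 n : 0 < a n.
  rewrite lt_def enorm_ge0 andbT; apply/eqP => an0.
  have [_ _] := hf n; rewrite -/(a n) an0 !mulr0 mxformE big1 ?ltxx // => i _.
  rewrite big_nat_cond big1 ?mulr0 // => j /andP[/andP[_ jN] _].
  by rewrite [(f n).2.2 j](enorm_eq0 an0) // mulr0.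
pose z n := restrict (N n) (fun j => (a n)^-1 * x n j).
have z1 n K : \sum_(0 <= j < K) z n j ^+ 2 <= 1.
  rewrite -sqr_enorm expr_le1 ?enorm_ge0 //.
  apply: le_trans (enorm_restrict _ _ _) _; rewrite enormZ.
  by rewrite ger0_norm ?invr_ge0 ?enorm_ge0 // mulVf // gt_eqF ?a_gt0.
pose q n : R := 2^-1 ^+ n.
have q0 n : 0 <= q n by rewrite exprn_ge0 // invr_ge0.
have qz0 j n : 0 <= q n * z n j ^+ 2 by rewrite mulr_ge0 ?sqr_ge0.
have qzb j : sums_bounded (fun n => q n * z n j ^+ 2).
  exists 2 => L; apply: le_trans (sum_half_le2 L); apply: ler_sum_nat => n _.
  rewrite -[leRHS]mulr1 ler_wpM2l //; apply: le_trans (z1 n j.+1).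
  by apply: (ler_sum_term (u := fun j => z n j ^+ 2)) => // k; exact: sqr_ge0.
(* Since X combines squares with weights 2^-n, |X|^2 is a double sum of nonnegative terms, and
   exchanging the sums replaces a triangle inequality for infinitely many vectors. The total is at
   most the sum of the weights. *)
pose X j := Num.sqrt (rsum (fun n => q n * z n j ^+ 2)).
have X0 j : 0 <= X j by exact: sqrtr_ge0.
have lX : l2 X.
  apply/l2P; exists 2 => K.
  under eq_bigr do rewrite sqr_sqrtr ?rsum_ge0 //.
  rewrite sum_rsum => [|j _]; last by apply: sums_bounded_norm.
  apply: rsum_le => [n|L]; first exact: sumr_ge0.
  apply: le_trans (sum_half_le2 L); apply: ler_sum_nat => n _.
  by rewrite -mulr_sumr -[leRHS]mulr1 ler_wpM2l.
have q1 n : q n <= 1 by rewrite exprn_ile1 // ?invr_ge0 // invf_le1 // ler1n.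
have zX n j : z n j <= 2 ^+ n * X j.
  rewrite -ler_pdivrMl ?exprn_gt0 // -exprVn.
  apply: le_trans (ler_norm _) _; rewrite -sqrtr_sqr; apply: ler_wsqrtr.
  have qz := ler_sum_term (qz0 j) (ltnSn n).
  apply: le_trans (sum_le_rsum (qz0 j) (qzb j) n.+1); apply: le_trans qz.
  by rewrite exprMn ler_wpM2r ?sqr_ge0 // expr2 -[leRHS]mulr1 ler_wpM2l.
have [sX lAX] := dA X lX.
have rowX i K : \sum_(0 <= j < K) A i j * X j <= mxapp A X i.
  have p0 j : 0 <= A i j * X j by rewrite mulr_ge0.
  apply: sum_le_rsum => //.
  have := (nneseries_ltyP (fun j => normr_ge0 (A i j * X j))).1 (sX i).
  by congr sums_bounded; apply/funext => j; rewrite ger0_norm.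
have AX0 i : 0 <= mxapp A X i by apply: le_trans (rowX i 0%N); rewrite big_geq.
suff D n : 2 ^+ n < l2norm (mxapp A X).
  have := D (Num.truncn (l2norm (mxapp A X))).+1.
  rewrite ltNge => /negP; apply.
  apply: le_trans (ltW (truncnS_gt _)) _.
  by rewrite -natrX ler_nat ltnW // ltn_expl.
have [y0 x0 ltf] := hf n; move: ltf y0 x0.
rewrite -/(x n) -/(N n) -/(a n); set y := (f n).2.1; set M := (f n).1.1 => ltf y0 x0.
have : 4 ^+ n * (enorm y M * a n) < a n * 2 ^+ n * (enorm y M * l2norm (mxapp A X)).
  apply: lt_le_trans ltf _; rewrite mxformE.
  apply: (@le_trans _ _ (a n * 2 ^+ n * \sum_(0 <= i < M) y i * mxapp A X i)).
    rewrite mulr_sumr; apply: ler_sum_nat => i _.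
    rewrite mulrCA ler_wpM2l //; apply: (le_trans _ (ler_wpM2l _ (rowX i (N n)))).
      rewrite mulr_sumr; apply: ler_sum_nat => j /andP[_ jN].
      rewrite mulrCA ler_wpM2l // -mulrA.
      apply: le_trans (ler_wpM2l (ltW (a_gt0 n)) (zX n j)).
      by rewrite /z /restrict jN mulrA divff ?mul1r // gt_eqF.
    by rewrite mulr_ge0 ?exprn_ge0 // ltW.
  rewrite ler_wpM2l ?mulr_ge0 ?exprn_ge0 ?(ltW (a_gt0 n)) //.
  apply: le_trans (cauchy_schwarz_enorm _ _ _) _.
  by rewrite ler_wpM2l ?enorm_ge0 // enorm_le_l2norm.
(* Cancelling a_n 2^n |y| leaves 2^n < |A X|; the strict inequality rules out a zero factor. *)
have -> : (4 : R) ^+ n = 2 ^+ n * 2 ^+ n by rewrite -exprMn -natrM.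
rewrite -subr_gt0.
have -> : a n * 2 ^+ n * (enorm y M * l2norm (mxapp A X)) - 2 ^+ n * 2 ^+ n * (enorm y M * a n)
  = (a n * 2 ^+ n * enorm y M) * (l2norm (mxapp A X) - 2 ^+ n) by ring.
have : 0 <= a n * 2 ^+ n * enorm y M by rewrite !mulr_ge0 ?exprn_ge0 ?enorm_ge0.
rewrite le_eqVlt => /orP[/eqP <-|h]; first by rewrite mul0r ltxx.
by rewrite pmulr_rgt0 // subr_gt0.
Qed.

Lemma l2_0 : l2 (0 : nat -> R).
Proof. by apply: (@enorm_l2 _ 0) => N; apply: enorm_le => //; rewrite big1 // => k _; rewrite !expr0n. Qed.

Lemma l2norm0 : l2norm (0 : nat -> R) <= 0.
Proof. by apply: l2norm_le => N; apply: enorm_le => //; rewrite big1 // => k _; rewrite !expr0n. Qed.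

Lemma opnorm_le (T : l2op R) c :
  (forall x, l2 x -> l2norm x <= 1 -> l2norm (T x) <= c) -> opnorm T <= c.
Proof.
move=> h; apply: ge_sup.
  by exists (l2norm (T 0)); exists 0 => //; split; [exact: l2_0|exact: le_trans l2norm0 _].
by move=> _ [x [lx x1] <-]; exact: h.
Qed.

(** The bound c makes [opnorm T] a true supremum and not the default 0. *)
Lemma le_opnorm (T : l2op R) c x :
  (forall x, l2 x -> l2norm x <= 1 -> l2norm (T x) <= c) ->
  l2 x -> l2norm x <= 1 -> l2norm (T x) <= opnorm T.
Proof.
move=> h lx x1; apply: ub_le_sup; last by exists x.
by exists c => _ [y [ly y1] <-]; exact: h.
Qed.

Lemma l2norm_mxapp_unit A c x : nonneg_mx A -> mxbound A c -> l2 x -> l2norm x <= 1 ->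
  l2norm (mxapp A x) <= c.
Proof.
move=> A0 Ac lx x1; apply: le_trans (l2norm_mxapp A0 Ac lx) _.
by rewrite ler_piMr ?(mxbound_ge0 A0 Ac).
Qed.

Lemma opnorm_ge0 (T : l2op R) : 0 <= opnorm T.
Proof.
by apply: sup_nonneg => _ [x _ <-]; exact: l2norm_ge0.
Qed.

Lemma mxbound_opnorm A : opmx A -> mxbound A (opnorm (mxapp A)).
Proof.
move=> oA; have [A0 [c Ac]] := oA.
apply: mxbound_of_mxapp => //; first exact: opnorm_ge0.
move=> x lx x1; split; first exact: mxapp_l2.
by apply: (le_opnorm (c := c)) => // y ly y1; exact: l2norm_mxapp_unit.
Qed.

End EllTwo.

(** * Measure of noncompactness and essential norm computed by tails *)

Section Noncompactness.
Variable R : realType.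
Implicit Types (A B C : mx R) (x y u v w : nat -> R) (c d e s t : R).

Definition vtail n v : nat -> R := fun i => if (n <= i)%N then v i else 0.

Lemma mxapp_tail n A x : mxapp (tail n A) x = vtail n (mxapp A x).
Proof.
apply/funext => i; rewrite /mxapp /vtail /tail; case: ifP => // _.
by rewrite -[RHS](rsum0 R); congr rsum; apply/funext => j; rewrite mul0r.
Qed.

Lemma ler_enorm_vtail n v N : enorm (vtail n v) N <= enorm v N.
Proof. by apply: ler_enorm => k _; rewrite /vtail; case: ifP => // _; rewrite normr0. Qed.

Lemma l2_vtail n v : l2 v -> l2 (vtail n v).
Proof.
move=> lv; apply: (@enorm_l2 _ _ (l2norm v)) => N.
by apply: le_trans (ler_enorm_vtail _ _ _) _; exact: enorm_le_l2norm.
Qed.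

Lemma l2norm_vtail n v : l2 v -> l2norm (vtail n v) <= l2norm v.
Proof.
move=> lv; apply: l2norm_le => N.
by apply: le_trans (ler_enorm_vtail _ _ _) _; exact: enorm_le_l2norm.
Qed.

Lemma vtail_mono m n v : (m <= n)%N -> l2 v -> l2norm (vtail n v) <= l2norm (vtail m v).
Proof.
move=> mn lv; apply: l2norm_le => N; apply: le_trans (enorm_le_l2norm N (l2_vtail m lv)).
apply: ler_enorm => k _; rewrite /vtail; case: leqP => nk; last by rewrite normr0.
by rewrite (leq_trans mn nk).
Qed.

Lemma l2norm_vtail_sub n v w : l2 v -> l2 w ->
  l2norm (vtail n v) <= l2norm (v - w) + l2norm (vtail n w).
Proof.
move=> lv lw; have := l2norm_sub_le (l2_vtail n lv) (l2_vtail n lw).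
have -> : vtail n v - vtail n w = vtail n (v - w).
  by apply/funext => i; rewrite !fctE /vtail; case: ifP => // _; rewrite subr0.
move=> h; apply: (le_trans h); rewrite lerD2r.
by apply: l2norm_vtail; exact: l2_sub.
Qed.

Lemma vtail_small v e : l2 v -> 0 < e ->
  exists n, forall m, (n <= m)%N -> l2norm (vtail m v) <= e.
Proof.
move=> lv e0; have [n hn] := tail_sum_small (fun k => sqr_ge0 (v k)) ((l2P v).1 lv)
  (exprn_gt0 2 e0).
exists n => m nm; apply: le_trans (vtail_mono nm lv) _.
apply: l2norm_le => N; apply: enorm_le; first exact: ltW.
apply: le_trans (hn N); apply: ler_sum_nat => k _; rewrite /vtail; case: ifP => // _.
by rewrite expr0n.
Qed.

(** The lower-bound argument shared by both quantities: if the points A x are within d of vectors w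
    with uniformly small tails, the tails of A x are at most d + e. For [hmnc] the w are finitely
    many centres, for [ess_norm] the vectors K x. *)
Lemma tau_le_uniform_tail A d : opmx A -> 0 <= d ->
  (forall e, 0 < e -> exists n, forall x, l2 x -> l2norm x <= 1 ->
     exists w, [/\ l2 w, l2norm (mxapp A x - w) <= d & l2norm (vtail n w) <= e]) ->
  tau A <= d.
Proof.
move=> oA d0 h; have [A0 _] := oA; apply/ler_addgt0Pr => e e0.
have [n hn] := h e e0; apply: (@tau_le _ _ _ n) => //.
apply: mxbound_of_mxapp; first exact: nonneg_tail.
  by rewrite addr_ge0 // ltW.
move=> x lx x1; rewrite mxapp_tail; have lAx := mxapp_l2 oA lx.
split; first exact: l2_vtail.
have [w [lw wd we]] := hn x lx x1.
by apply: le_trans (l2norm_vtail_sub n lAx lw) _; exact: lerD.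
Qed.

Lemma grid c e : 0 < e -> exists g : seq R,
  forall t, `|t| <= c -> exists2 a, a \in g & `|t - a| <= e.
Proof.
move=> e0; exists [seq - c + e * i%:R | i <- iota 0 (Num.truncn (2 * c / e)).+1].
move=> t tc; have tc0 : 0 <= t + c by move: tc; rewrite ler_norml; lra.
have q0 : 0 <= (t + c) / e by rewrite divr_ge0 // ltW.
set k := Num.truncn ((t + c) / e).
exists (- c + e * k%:R).
  apply: (map_f (fun i : nat => - c + e * i%:R)); rewrite mem_iota /= add0n ltnS.
  apply: le_truncn; rewrite ler_pM2r ?invr_gt0 //.
  by move: tc; rewrite ler_norml; lra.
have := truncn_itv q0; rewrite -/k => /andP[].
rewrite ler_pdivlMr // ltr_pdivrMr // -natr1 mulrDl mul1r [_ * e]mulrC => h1 h2.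
by rewrite ler_norml; apply/andP; split; lra.
Qed.

Lemma enorm_single n (a : R) N : enorm (fun k => if k == n then a else 0) N <= `|a|.
Proof.
apply: enorm_le => //; rewrite real_normK ?num_real //.
have [nN|Nn] := ltnP n N.
  rewrite (bigD1_seq n) ?mem_index_iota ?iota_uniq //= eqxx big1 ?addr0 // => k kn.
  by rewrite (negbTE kn) expr0n.
rewrite big_nat_cond big1 ?sqr_ge0 // => k /andP[/andP[_ kN] _].
by rewrite ltn_eqF ?expr0n // (leq_trans kN).
Qed.

(** Total boundedness of bounded sets in dimension n: the net grows by one coordinate at a time,
    each new coordinate running over a finite grid with half of the error. *)
Lemma finite_dim_net n c e : 0 < e -> exists s : seq (vec R),
  (forall y, y \in s -> l2 y) /\
  forall v, (forall i, (i < n)%N -> `|v i| <= c) ->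
    exists2 y, y \in s & forall N, enorm (fun i => restrict n v i - y i) N <= e.
Proof.
elim: n e => [|n IH] e e0.
  exists [:: 0]; split=> [y|v _]; first by rewrite inE => /eqP ->; exact: l2_0.
  exists 0; first by rewrite inE.
  move=> N; apply: enorm_le; first exact: ltW.
  by rewrite big1 ?exprn_ge0 ?(ltW e0) // => k _; rewrite /restrict ltn0 subr0 expr0n.
have e2 : 0 < e / 2 by rewrite divr_gt0.
have [s [ls hs]] := IH _ e2; have [g hg] := grid c e2.
exists [seq (fun k => y k + if k == n then a else 0) | y <- s, a <- g]; split.
  move=> _ /allpairsP[[y a] /= [ys _ ->]].
  apply: (@enorm_l2 _ _ (l2norm y + `|a|)) => N; apply: le_trans (enormD _ _ _) _.
  by apply: lerD; [apply: enorm_le_l2norm; exact: ls|exact: enorm_single].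
move=> v vc; have [y ys hy] := hs v (fun i ni => vc i (ltnW ni)).
have [a ag ha] := hg (v n) (vc n (ltnSn n)).
exists (fun k => y k + if k == n then a else 0).
  by apply/allpairsP; exists (y, a).
move=> N; rewrite [e]splitr.
apply: le_trans (lerD (hy N) (le_trans (enorm_single n (v n - a) N) ha)).
apply: le_trans (enormD _ _ _); rewrite le_eqVlt; apply/orP; left; apply/eqP.
congr enorm; apply/funext => k; rewrite /restrict ltnS.
by case: (ltngtP k n) => [_|_|->]; rewrite ?addr0 //; ring.
Qed.

Lemma enorm_restrict_vtail n v y N :
  enorm (fun i => v i - y i) N <=
  enorm (fun i => restrict n v i - y i) N + enorm (vtail n v) N.
Proof.
apply: le_trans (enormD _ _ _); apply: ler_enorm => k _.
rewrite /restrict /vtail; case: ltnP => _; first by rewrite addr0.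
by rewrite sub0r addrC.
Qed.

Lemma mxapp_coord A c x i : nonneg_mx A -> mxbound A c -> l2 x -> l2norm x <= 1 ->
  `|mxapp A x i| <= c.
Proof.
move=> A0 Ac lx x1; apply: le_trans (enorm_term _ (ltnSn i)) _.
apply: le_trans (enorm_mxapp i.+1 A0 Ac lx) _.
by rewrite ler_piMr // (mxbound_ge0 A0 Ac).
Qed.

Lemma vtail_mxapp_le n A c x : nonneg_mx A -> mxbound (tail n A) c -> l2 x ->
  l2norm x <= 1 -> l2norm (vtail n (mxapp A x)) <= c.
Proof.
by move=> A0 nA lx x1; rewrite -mxapp_tail; apply: l2norm_mxapp_unit nA lx x1; exact: nonneg_tail.
Qed.

(** Upper bound: on the image of the unit ball the first n coordinates have a finite e/2-net and the
    others have norm at most tau A + e/2. Lower bound: finitely many centres in l2 share a tail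
    index. *)
Lemma hmnc_tau A : opmx A -> hmnc A = tau A.
Proof.
move=> oA; have [A0 [c Ac]] := oA.
have up e : 0 < e -> 0 <= tau A + e /\ exists s : seq (vec R), (forall y, y \in s -> l2 y) /\
    forall x, l2 x -> l2norm x <= 1 ->
    exists2 y, y \in s & l2norm (mxapp A x - y) <= tau A + e.
  move=> e0; split; first by rewrite addr_ge0 ?tau_ge0 // ltW.
  have e2 : 0 < e / 2 by rewrite divr_gt0.
  have [n nA] := tau_near oA e2; have [s [ls hs]] := finite_dim_net n c e2.
  exists s; split=> // x lx x1.
  have [i _|y ys hy] := hs (mxapp A x); first exact: mxapp_coord.
  exists y => //; apply: l2norm_le => N.
  apply: le_trans (enorm_restrict_vtail n _ _ _) _.
  have -> : tau A + e = e / 2 + (tau A + e / 2) by lra.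
  apply: lerD => //; apply: le_trans (enorm_le_l2norm _ _) _.
    by apply: l2_vtail; exact: mxapp_l2.
  exact: vtail_mxapp_le.
apply: le_anti; apply/andP; split.
  apply/ler_addgt0Pr => e e0; apply: ge_inf; last exact: up.
  by exists 0 => d [d0 _].
apply: lb_le_inf; first by exists (tau A + 1); exact: up.
move=> d [d0 [s [ls hs]]]; apply: tau_le_uniform_tail => // e e0.
have [n hn] : exists n, forall y, y \in s -> l2norm (vtail n y) <= e.
  elim: s ls {hs} => [|z s IH] ls; first by exists 0%N.
  have [n hn] := IH (fun y ys => ls y (mem_behead (s := z :: s) ys)).
  have [m hm] := vtail_small (ls z (mem_head _ _)) e0.
  exists (maxn n m) => y; rewrite inE => /orP[/eqP ->|ys].
    by apply: hm; exact: leq_maxr.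
  apply: le_trans (hn y ys); apply: vtail_mono; first exact: leq_maxl.
  by apply: ls; rewrite inE ys orbT.
exists n => x lx x1; have [y ys hy] := hs x lx x1.
by exists y; split => //; [exact: ls|exact: hn].
Qed.

Lemma increasing_ge (f : nat -> nat) : (forall n, (f n < f n.+1)%N) -> forall n, (n <= f n)%N.
Proof. by move=> h; elim=> // n IH; exact: leq_ltn_trans (h n). Qed.

Lemma increasing_mono (f : nat -> nat) : (forall n, (f n < f n.+1)%N) ->
  forall m n, (m < n)%N -> (f m < f n)%N.
Proof.
move=> h m; elim=> // n IH; rewrite ltnS leq_eqVlt => /orP[/eqP ->|/IH lt]; first exact: h.
exact: ltn_trans lt (h n).
Qed.

Lemma cvg_subseq u (l : R) (f : nat -> nat) : (forall n, (f n < f n.+1)%N) ->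
  u n @[n --> \oo] --> l -> u (f n) @[n --> \oo] --> l.
Proof.
move=> fi h V /h [N _ hN]; exists N => // n /= Nn; apply: hN => /=.
exact: leq_trans Nn (increasing_ge fi n).
Qed.

Lemma bolzano_weierstrass_coord n c (w : nat -> nat -> R) :
  (forall k i, (i < n)%N -> `|w k i| <= c) ->
  exists (f : nat -> nat) y, (forall k, (f k < f k.+1)%N) /\
    forall i, (i < n)%N -> w (f k) i @[k --> \oo] --> y i.
Proof.
elim: n => [|n IH] wc; first by exists id, 0.
have [f [y [fi fy]]] := IH (fun k i ni => wc k i (ltnW ni)).
have [|g gi /cvg_ex [l gl]] := @bolzano_weierstrass R (fun k => w (f k) n).
  exists c; split; first exact: num_real.
  by move=> M cM k _ /=; apply: le_trans (ltW cM); exact: wc.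
have gi' k : (g k < g k.+1)%N by have /increasing_seqP := gi; exact.
exists (f \o g), (fun i => if i == n then l else y i); split.
  by move=> k; apply: (increasing_mono fi); exact: gi'.
move=> i; rewrite ltnS leq_eqVlt => /orP[/eqP ->|ni]; first by rewrite eqxx.
rewrite (ltn_eqF ni); exact: (cvg_subseq gi' (fy i ni)).
Qed.

Lemma enorm_le_sum u N : enorm u N <= \sum_(0 <= k < N) `|u k|.
Proof.
apply: enorm_le; first exact: sumr_ge0.
rewrite expr2 [leRHS]mulr_suml; apply: ler_sum_nat => k /andP[_ kN].
rewrite -real_normK ?num_real // expr2 ler_wpM2l //.
exact: (ler_sum_term (u := fun k => `|u k|)).
Qed.

Lemma l2_restrict n v : l2 (restrict n v).
Proof. by apply: (@enorm_l2 _ _ (enorm v n)) => N; exact: enorm_restrict. Qed.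

Lemma mxapp_lin A x y c : opmx A -> l2 x -> l2 y ->
  mxapp A (c *: x + y) = c *: mxapp A x + mxapp A y.
Proof.
move=> oA lx ly; apply/funext => i.
have sx := mxapp_sums_bounded i oA lx; have sy := mxapp_sums_bounded i oA ly.
rewrite /mxapp !fctE -[X in _ = X + _]/(c * rsum (fun j => A i j * x j)) -rsumZ // -rsumD //.
  congr rsum; apply/funext => j; rewrite mulrDr; congr (_ + _).
  by rewrite -[c *: x j]/(c * x j) mulrCA.
have [d hd] := sx; exists (`|c| * d) => N.
by under eq_bigr do rewrite normrM; rewrite -mulr_sumr ler_wpM2l.
Qed.

(** The range lies in an n-dimensional space, where bounded coordinates suffice for a convergent
    subsequence. *)
Lemma compact_restrict_mxapp n A : opmx A -> compact_op (fun x => restrict n (mxapp A x)).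
Proof.
move=> oA; have [A0 [c Ac]] := oA; split.
  split=> [x lx|]; first exact: l2_restrict.
  split=> [x y a lx ly|].
    apply/funext => i; rewrite /restrict mxapp_lin // !fctE /=; case: ifP => // _.
    by rewrite scaler0 addr0.
  exists c => x lx; apply: l2norm_le => N; apply: le_trans (enorm_restrict _ _ _) _.
  exact: enorm_mxapp.
move=> u hu.
have [|f [y [fi fy]]] := @bolzano_weierstrass_coord n c (fun k => mxapp A (u k)).
  by move=> k i _; have [lu u1] := hu k; exact: mxapp_coord.
exists f, (restrict n y); split=> //; split; first exact: l2_restrict.
have h : \sum_(0 <= i < n) `|mxapp A (u (f k)) i - y i| @[k --> \oo] --> (0 : R).
  have z : \sum_(0 <= i < n) (0 : R) = 0 by rewrite big1.
  rewrite -[X in _ --> X]z.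
  apply: (@cvg_sum_range _ (fun i k => `|mxapp A (u (f k)) i - y i|) (fun=> 0)) => i ni.
  rewrite -[X in _ --> X](normr0 R); apply: cvg_norm.
  by rewrite -(subrr (y i)); apply: cvgB; [exact: fy|exact: cvg_cst].
apply: (squeeze_cvgr _ (cvg_cst 0) h); apply: nearW => k; apply/andP; split.
  exact: l2norm_ge0.
apply: l2norm_le => N; apply: le_trans (enorm_le_sum _ n).
apply: le_trans (enorm_restrict _ _ N).
by apply: ler_enorm => i _; rewrite /restrict !fctE; case: ifP => // _; rewrite subr0.
Qed.

(** Subtracting the compact truncation to the first n coordinates leaves the tail, which gives the
    upper bound. For the lower bound, a compact K maps the unit ball to a set with uniformly small
    tails. *)
Lemma ess_norm_tau A : opmx A -> ess_norm (mxapp A) = tau A.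
Proof.
move=> oA; have [A0 [c Ac]] := oA.
have K0 n := compact_restrict_mxapp n oA.
apply: le_anti; apply/andP; split.
  apply/ler_addgt0Pr => e e0; have [n nA] := tau_near oA e0.
  apply: (@le_trans _ _ (opnorm (mxapp A - (fun x => restrict n (mxapp A x))))).
    apply: ge_inf; last by exists (fun x => restrict n (mxapp A x)).
    by exists 0 => _ [K _ <-]; exact: opnorm_ge0.
  apply: opnorm_le => x lx x1.
  have -> : (mxapp A - (fun x => restrict n (mxapp A x))) x = vtail n (mxapp A x).
    apply/funext => i; rewrite /vtail; change (mxapp A x i - restrict n (mxapp A x) i = vtail n (mxapp A x) i).
    by rewrite /vtail /restrict; case: ltnP => _; rewrite ?subrr ?subr0.
  exact: vtail_mxapp_le.
apply: lb_le_inf.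
  by exists (opnorm (mxapp A - (fun x => restrict 0 (mxapp A x)))); exists (fun x => restrict 0 (mxapp A x)).
move=> _ [K [[Kl2 [_ [D KD]]] Kc] <-]; apply: tau_le_uniform_tail => //.
  exact: opnorm_ge0.
move=> e e0.
(* A bound on the unit ball is exhibited first, so that [opnorm] of the difference is a true
   supremum; [|D|] appears because D carries no sign. *)
have bd x : l2 x -> l2norm x <= 1 -> l2norm ((mxapp A - K) x) <= opnorm (mxapp A - K).
  apply: (le_opnorm (c := c + `|D|)) => z lz z1.
  have lA := mxapp_l2 oA lz; have lK := Kl2 z lz.
  apply: l2norm_le => N.
  have -> : (mxapp A - K) z = fun k => mxapp A z k + -1 * K z k.
    by apply/funext => k; rewrite mulN1r.
  apply: le_trans (enormD _ _ _) _; rewrite enormZ normrN1 mul1r.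
  apply: lerD.
    by apply: le_trans (enorm_mxapp N A0 Ac lz) _; rewrite ler_piMr // (mxbound_ge0 A0 Ac).
  apply: le_trans (enorm_le_l2norm N lK) _; apply: le_trans (KD z lz) _.
  apply: le_trans (ler_norm _) _; rewrite normrM.
  by rewrite ler_piMr // ger0_norm ?l2norm_ge0.
suff [n hn] : exists n, forall x, l2 x -> l2norm x <= 1 -> l2norm (vtail n (K x)) <= e.
  exists n => x lx x1; exists (K x); split; [exact: Kl2|exact: bd|exact: hn].
(* Otherwise some u_n in the unit ball has K u_n with tail beyond n larger than e. Along a
   subsequence K u_(f k) tends to y; far out, the distance to y and the tail of y are both at most
   e/2, a contradiction. *)
apply: contrapT => nh.
have : forall n, exists x, (l2 x /\ l2norm x <= 1) /\ e < l2norm (vtail n (K x)).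
  move=> n; apply: contrapT => hx; apply: nh; exists n => x lx x1.
  by rewrite leNgt; apply/negP => lt; apply: hx; exists x.
move=> /choice [u hu].
have [f [y [fi [ly fy]]]] := Kc u (fun n => (hu n).1).
have e2 : 0 < e / 2 by rewrite divr_gt0.
have [m hm] := vtail_small ly e2.
have /cvgrPdist_le /(_ _ e2) [k0 _ hk] := fy.
pose k := maxn k0 m.
have [[lu u1] uk] := hu (f k).
have := hk k (leq_maxl _ _); rewrite /= sub0r normrN ger0_norm ?l2norm_ge0 // => h1.
have h2 := hm (f k) (leq_trans (leq_maxr k0 m) (increasing_ge fi k)).
have := l2norm_vtail_sub (f k) (Kl2 _ lu) ly.
by rewrite leNgt => /negP; apply; apply: le_lt_trans uk; rewrite [e]splitr lerD.
Qed.

End Noncompactness.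

(** * Roots of submultiplicative sequences *)

Section Roots.
Variable R : realType.
Implicit Types (a c d e s t l : R) (u : nat -> R).

Lemma root_exprn c m : 0 <= c -> (0 < m)%N -> (c ^+ m) `^ m%:R^-1 = c.
Proof.
move=> c0 m0; rewrite -powR_mulrn // -powRrM divff ?powRr1 //.
by rewrite pnatr_eq0 -lt0n.
Qed.

Lemma exprn_root c m : 0 <= c -> (0 < m)%N -> (c `^ m%:R^-1) ^+ m = c.
Proof.
move=> c0 m0; rewrite -powR_mulrn ?powR_ge0 // -powRrM mulVf ?powRr1 //.
by rewrite pnatr_eq0 -lt0n.
Qed.

Lemma powR_exprAC c s m : 0 <= c -> (c ^+ m) `^ s = (c `^ s) ^+ m.
Proof. by move=> c0; rewrite -!powR_mulrn ?powR_ge0 // powRAC. Qed.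

Lemma cvg_invn : (n%:R^-1 : R) @[n --> \oo] --> (0 : R).
Proof. by rewrite -cvg_shiftS; exact: cvg_harmonic. Qed.

Lemma cvg_const_root c : 0 < c -> c `^ n%:R^-1 @[n --> \oo] --> (1 : R).
Proof.
move=> c0; rewrite -[X in _ --> X]expR0 -[X in _ --> expR X](mul0r (ln c)).
rewrite /powR gt_eqF //.
have h : n%:R^-1 * ln c @[n --> \oo] --> 0 * ln c by apply: cvgMl; exact: cvg_invn.
exact: (cvg_comp _ _ h (@continuous_expR R _)).
Qed.

(* Fekete's lemma in multiplicative form. *)
Lemma submultiplicative_root_cvg u : (forall m, 0 <= u m) ->
  (forall m n, (0 < m)%N -> (0 < n)%N -> u (m + n)%N <= u m * u n) ->
  cvgn (fun m => u m `^ m%:R^-1).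
Proof.
move=> u0 um.
set E := [set u m `^ m%:R^-1 | m in [set m : nat | (0 < m)%N]].
have E1 : E !=set0 by exists (u 1%N `^ 1%:R^-1); exists 1%N.
have El : has_lbound E by exists 0 => _ [m _ <-]; exact: powR_ge0.
have L0 : 0 <= inf E by apply: lb_le_inf => // _ [m _ <-]; exact: powR_ge0.
apply/cvg_ex; exists (inf E); apply/cvgrPdist_le => e e0.
pose c := inf E + e / 2.
have c0 : 0 < c by rewrite ltr_wpDl // divr_gt0.
have [_ [d /= d0 <-] dc] : exists2 y, E y & y < c by apply: inf_lt => //; rewrite ltrDl divr_gt0.
have udc : u d <= c ^+ d.
  by rewrite -(exprn_root (u0 d) d0) lerXn2r ?nnegrE ?powR_ge0 ?(ltW c0) ?(ltW dc).
(* [M] dominates u r / c ^+ r for every r <= d, and the summand 1 keeps it positive. Strong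
   induction removes d factors at a time by u d <= c ^+ d, so u m <= M c ^+ m, and the m-th root of
   M tends to 1. *)
pose M := 1 + \sum_(0 <= r < d.+1) u r / c ^+ r.
have T0 r : 0 <= u r / c ^+ r by rewrite divr_ge0 // exprn_ge0 // ltW.
have M0 : 0 < M by rewrite ltr_pwDl // sumr_ge0.
have uM m : (0 < m)%N -> u m <= M * c ^+ m.
  elim/ltn_ind: m => m IH m0; have [md|dm] := leqP m d.
    rewrite -ler_pdivrMr ?exprn_gt0 //.
    by apply: le_trans (ler_sum_term (N := d.+1) T0 md) _; rewrite lerDr.
  have m' : (0 < m - d)%N by rewrite subn_gt0.
  rewrite -(subnK (ltnW dm)); apply: le_trans (um _ _ m' d0) _.
  rewrite exprD mulrA; apply: ler_pM => //; apply: IH => //.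
  by rewrite ltn_subrL d0 (ltn_trans d0 dm).
have Mc : M `^ n%:R^-1 * c @[n --> \oo] --> 1 * c.
  by apply: cvgMl; exact: cvg_const_root.
rewrite mul1r in Mc; have e2 : 0 < e / 2 by rewrite divr_gt0.
have /cvgrPdist_le /(_ _ e2) nM := Mc.
near=> m.
have m0 : (0 < m)%N by near: m; exists 1%N.
have h1 : inf E <= u m `^ m%:R^-1 by apply: ge_inf => //; exists m.
have h2 : u m `^ m%:R^-1 <= M `^ m%:R^-1 * c.
  rewrite -[X in _ * X](root_exprn (ltW c0) m0) -powRM ?exprn_ge0 ?(ltW c0) ?(ltW M0) //.
  by apply: le_powR; rewrite ?invr_ge0 // uM.
have h3 : `|c - M `^ m%:R^-1 * c| <= e / 2 by near: m.
move: h3; rewrite !ler_norml => /andP[h3 h4]; apply/andP; split.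
  by rewrite /c in h2 h3 h4; lra.
by rewrite (le_trans _ (ltW e0)) // subr_le0.
Unshelve. all: by end_near. Qed.

Lemma lim_le_lim u v l t : (forall m, (0 < m)%N -> u m <= v m) ->
  u m @[m --> \oo] --> l -> v m @[m --> \oo] --> t -> l <= t.
Proof.
move=> uv ul vt; rewrite -(cvg_lim (@Rhausdorff R) ul) -(cvg_lim (@Rhausdorff R) vt).
apply: ler_lim; [exact: cvgP ul|exact: cvgP vt|].
by exists 1%N => // m; exact: uv.
Qed.

Lemma cvg_even u l : u m @[m --> \oo] --> l -> u (m + m)%N @[m --> \oo] --> l.
Proof.
by apply: (@cvg_subseq _ _ _ (fun m => m + m)%N) => n; rewrite addSn addnS !ltnS leqnSn.
Qed.

End Roots.

(** * The essential spectral radius of one matrix *)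

Section EssentialRadius.
Variable R : realType.
Implicit Types (A B C : mx R) (c d e s t : R).


Lemma nonneg_mxpow A m : nonneg_mx A -> nonneg_mx (mxpow A m).
Proof.
move=> A0; elim: m => [|m IH]; first by move=> i j; exact: ler0n.
exact: nonneg_mxmul.
Qed.

Lemma mxbound_pow A c m : nonneg_mx A -> mxbound A c -> (0 < m)%N ->
  mxbound (mxpow A m) (c ^+ m).
Proof.
move=> A0 Ac; elim: m => // -[_ _|m IH _]; first by rewrite /= mxmul1r.
rewrite exprS; exact: (mxbound_mul A0 (nonneg_mxpow m.+1 A0) Ac (IH isT)).
Qed.

Lemma rho_essE A : opmx A ->
  rho_ess A = limn (fun m => tau (mxpow A m) `^ m%:R^-1).
Proof.
move=> oA; congr (limn _); apply/funext => m; rewrite ess_norm_tau //.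
exact: opmx_pow.
Qed.

Lemma rho_ess_cvg A : opmx A ->
  tau (mxpow A m) `^ m%:R^-1 @[m --> \oo] --> rho_ess A.
Proof.
move=> oA; rewrite rho_essE //; apply: submultiplicative_root_cvg => [m|m n _ _].
  by apply: tau_ge0; exact: opmx_pow.
by rewrite mxpowD //; apply: tau_mul; exact: opmx_pow.
Qed.

Lemma rho_ess_ge0 A : opmx A -> 0 <= rho_ess A.
Proof.
move=> oA; apply: (lim_le_lim _ (cvg_cst 0) (rho_ess_cvg oA)) => m _.
exact: powR_ge0.
Qed.

Lemma rho_ess_le A c : nonneg_mx A -> mxbound A c -> rho_ess A <= c.
Proof.
move=> A0 Ac; have oA : opmx A by split; last exists c.
apply: (lim_le_lim _ (rho_ess_cvg oA) (cvg_cst c)) => m m0.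
rewrite -[leRHS](root_exprn (mxbound_ge0 A0 Ac) m0); apply: le_powR.
- by apply: tau_ge0; exact: opmx_pow.
- by rewrite invr_ge0.
- by apply: tau_le_bound; [exact: nonneg_mxpow|exact: mxbound_pow].
Qed.

Lemma ler_mxpow A B m : nonneg_mx A -> (forall i j, A i j <= B i j) -> opmx B ->
  forall i j, mxpow A m i j <= mxpow B m i j.
Proof.
move=> A0 AB oB; elim: m => // m IH i j /=.
by apply: ler_mxmul => //; [exact: nonneg_mxpow|exact: opmx_pow].
Qed.

Lemma rho_ess_mono A B : nonneg_mx A -> (forall i j, A i j <= B i j) -> opmx B ->
  rho_ess A <= rho_ess B.
Proof.
move=> A0 AB oB; have oA := opmx_mono A0 AB oB.
apply: (lim_le_lim _ (rho_ess_cvg oA) (rho_ess_cvg oB)) => m _; apply: le_powR.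
- by apply: tau_ge0; exact: opmx_pow.
- by rewrite invr_ge0.
- by apply: tau_mono; [exact: nonneg_mxpow|exact: ler_mxpow|exact: opmx_pow].
Qed.

(** The m-th root of tau (A^(2m)) is the square of its 2m-th root, and the even indices form a
    subsequence. *)
Lemma rho_ess_sqr A : opmx A -> rho_ess (mxmul A A) = rho_ess A ^+ 2.
Proof.
move=> oA; rewrite rho_essE; last exact: opmx_mul.
apply: cvg_lim => //.
have -> : (fun m : nat => tau (mxpow (mxmul A A) m) `^ m%:R^-1) =
  (fun m : nat => tau (mxpow A (m + m)) `^ (m + m)%:R^-1 *
    tau (mxpow A (m + m)) `^ (m + m)%:R^-1).
  apply/funext => m; rewrite mxpow_double // -powR_addM ?invr_ge0 //; congr (_ `^ _).
  have [->|m0] := posnP m; first by rewrite addn0 invr0 addr0.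
  have mn0 : m%:R != 0 :> R by rewrite pnatr_eq0 -lt0n.
  rewrite natrD; field.
  by rewrite mn0 -natrD pnatr_eq0 addn_eq0 negb_and -lt0n m0.
by rewrite expr2; apply: cvgM; exact: (cvg_even (rho_ess_cvg oA)).
Qed.

(** Transposition moves the left factor A of the recursion to the right; A commutes with its powers,
    so it can be moved back. *)
Lemma mxpow_tr A m : opmx A -> mxpow (mxtr A) m = mxtr (mxpow A m).
Proof.
move=> oA; elim: m => [|m IH].
  by apply/funext => i; apply/funext => j; rewrite /mxtr /= /idmx eq_sym.
rewrite /= IH -mxtr_mul; congr mxtr.
have A1 : mxpow A 1 = A by exact: mxmul1r.
by rewrite -{2 3}A1 -!mxpowD // addnC.
Qed.

Lemma mxpow_hadamard_le s t A B m : opmx A -> opmx B ->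
  0 <= s -> 0 <= t -> 1 <= s + t -> forall i j,
  mxpow (hadamard s t A B) m i j <= hadamard s t (mxpow A m) (mxpow B m) i j.
Proof.
move=> oA oB s0 t0 st; elim: m => [|m IH] i j.
  rewrite /= /hadamard /hmul /hpow /idmx; case: eqP => _ /=.
    by rewrite !powR1 mulr1.
  by rewrite mulr_ge0 ?powR_ge0.
have oAm := opmx_pow m oA; have oBm := opmx_pow m oB.
apply: le_trans (hadamard_mul_le oA oAm oB oBm s0 t0 st i j).
apply: ler_mxmul => //; try exact: nonneg_hadamard.
- by apply: nonneg_mxpow; exact: nonneg_hadamard.
- exact: opmx_hadamard.
- exact: opmx_hadamard.
Qed.

Lemma rho_ess_hadamard s t A B : opmx A -> opmx B ->
  0 <= s -> 0 <= t -> 1 <= s + t ->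
  rho_ess (hadamard s t A (mxtr B)) <= rho_ess A `^ s * rho_ess B `^ t.
Proof.
move=> oA oB s0 t0 st; have oB' := opmx_tr oB.
have oH := opmx_hadamard oA oB' s0 t0 st.
have h : (tau (mxpow A m) `^ m%:R^-1) `^ s * (tau (mxpow B m) `^ m%:R^-1) `^ t
  @[m --> \oo] --> rho_ess A `^ s * rho_ess B `^ t.
  by apply: cvgM; apply: cvg_powR => //;
    first [exact: rho_ess_cvg|by move=> n; exact: powR_ge0].
apply: (lim_le_lim _ (rho_ess_cvg oH) h) => m _.
rewrite ![(_ `^ m%:R^-1) `^ _]powRAC -powRM ?powR_ge0 //; apply: le_powR.
- by apply: tau_ge0; exact: opmx_pow.
- by rewrite invr_ge0.
have oAm := opmx_pow m oA; have oBm := opmx_pow m oB; have oBm' := opmx_pow m oB'.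
apply: (@le_trans _ _ (tau (hadamard s t (mxpow A m) (mxpow (mxtr B) m)))).
  apply: tau_mono; first by apply: nonneg_mxpow; exact: nonneg_hadamard.
    exact: mxpow_hadamard_le.
  exact: opmx_hadamard.
by apply: le_trans (tau_hadamard oAm oBm' s0 t0 st) _; rewrite mxpow_tr // tau_tr.
Qed.

End EssentialRadius.

(** * Powers of bounded sets of matrices and entrywise domination *)

Section SetPowers.
Variable R : realType.
Implicit Types (A B C : mx R) (S T Phi : set (mx R)) (c d e s t : R).

(** [0 <= c] is stated separately because an empty S has no member that forces it. *)
Definition opset S := exists c, 0 <= c /\ forall A, S A -> nonneg_mx A /\ mxbound A c.

Lemma opset_opmx S A : opset S -> S A -> opmx A.
Proof. by move=> [c [c0 h]] /h [A0 Ac]; split=> //; exists c. Qed.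

Lemma setpowS S m : setpow S m.+2 = [set mxmul A B | A in S & B in setpow S m.+1].
Proof. by []. Qed.

Lemma setpow_bound S c m : (forall A, S A -> nonneg_mx A /\ mxbound A c) ->
  forall A, setpow S m.+1 A -> nonneg_mx A /\ mxbound A (c ^+ m.+1).
Proof.
move=> h; elim: m => [|m IH]; first exact: h.
move=> _ [A SA [B SB <-]]; have [A0 Ac] := h A SA; have [B0 Bc] := IH B SB.
split; first exact: nonneg_mxmul.
by rewrite exprS; exact: mxbound_mul.
Qed.

Lemma opset_setpow S m : opset S -> opset (setpow S m.+1).
Proof.
move=> [c [c0 h]]; exists (c ^+ m.+1); split; first exact: exprn_ge0.
exact: setpow_bound.
Qed.

Lemma setpow_opmx S m A : opset S -> setpow S m A -> opmx A.
Proof.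
case: m => [_ ->|m oS]; first exact: opmx1.
exact: (opset_opmx (opset_setpow m oS)).
Qed.

(** [setpow] nests products to the right, so joining two products uses associativity, for which
    [opset] is assumed. *)
Lemma setpow_mul_in S m n A B : opset S ->
  setpow S m.+1 A -> setpow S n.+1 B -> setpow S (m.+1 + n.+1) (mxmul A B).
Proof.
move=> oS; elim: m A => [|m IH] A; first by move=> SA SB; exists A => //; exists B.
move=> [A1 SA1 [A2 SA2 <-]] SB; exists A1 => //; exists (mxmul A2 B); first exact: IH.
rewrite -mxmulA //; [exact: opset_opmx SA1|exact: (@setpow_opmx _ m.+1 _ oS SA2)|exact: (@setpow_opmx _ n.+1 _ oS SB)].
Qed.

Lemma setpow_split S m n C : opset S -> setpow S (m.+1 + n.+1) C ->
  exists A B, [/\ setpow S m.+1 A, setpow S n.+1 B & C = mxmul A B].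
Proof.
move=> oS; elim: m C => [|m IH] C.
  by move=> [A SA [B SB <-]]; exists A, B.
move=> [A SA [B SB <-]]; have [B1 [B2 [S1 S2 ->]]] := IH B SB.
exists (mxmul A B1), B2; split=> //; first by exists A => //; exists B1.
rewrite mxmulA //; [exact: opset_opmx SA|exact: (@setpow_opmx _ m.+1 _ oS S1)|exact: (@setpow_opmx _ n.+1 _ oS S2)].
Qed.

Lemma setpow_mul S k m : opset S ->
  setpow (setpow S k.+1) m.+1 = setpow S (m.+1 * k.+1).
Proof.
move=> oS; elim: m => [|m IH]; first by rewrite mul1n.
apply/seteqP; split=> C.
  rewrite setpowS mulSn => -[A SA [B SB <-]].
  by rewrite IH in SB; exact: setpow_mul_in SB.
rewrite mulSn => /(@setpow_split S k (k + m * k.+1)) [//|A [B [SA SB ->]]].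
by rewrite setpowS; exists A => //; exists B => //; rewrite IH.
Qed.

Definition dominated S T := forall A, S A ->
  exists2 B, T B & forall i j, A i j <= B i j.

Lemma dominated_setpow S T m : opset S -> opset T -> dominated S T ->
  dominated (setpow S m.+1) (setpow T m.+1).
Proof.
move=> oS oT ST; elim: m => [|m IH]; first exact: ST.
rewrite !setpowS => _ [A SA [B SB <-]]; have [A' TA AA] := ST A SA; have [B' TB BB] := IH B SB.
exists (mxmul A' B'); first by exists A' => //; exists B'.
have [A0 _] := opset_opmx oS SA; have [B0 _] := setpow_opmx oS SB.
by apply: ler_mxmul => //; [exact: opset_opmx TA|exact: setpow_opmx TB].
Qed.

Section Hadamard.
Variables (s t : R).
Hypotheses (s0 : 0 <= s) (t0 : 0 <= t) (st : 1 <= s + t).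

Lemma SabP Phi C : Sab s t Phi C ->
  exists A B, [/\ Phi A, Phi B & C = hadamard s t A (mxtr B)].
Proof. by move=> [A PA [B PB <-]]; exists A, B. Qed.

Lemma opset_Sab Phi : opset Phi -> opset (Sab s t Phi).
Proof.
move=> [c [c0 h]]; exists (c `^ s * c `^ t); split; first by rewrite mulr_ge0 ?powR_ge0.
move=> _ [A PA [B PB <-]]; have [A0 Ac] := h A PA; have [B0 Bc] := h B PB.
split; first exact: nonneg_hadamard.
have B0' : nonneg_mx (mxtr B) by move=> i j; exact: B0.
exact: (mxbound_hadamard A0 B0' Ac (mxbound_tr Bc)).
Qed.

(* Transposition reverses products, so the second Hadamard factor of a product
   of m members of Sab is the transpose of a product taken in reverse order. *)
Lemma dominated_Sab Phi m : opset Phi ->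
  dominated (setpow (Sab s t Phi) m.+1) (Sab s t (setpow Phi m.+1)).
Proof.
move=> oP; have oS := opset_Sab oP.
elim: m => [|m IH]; first by move=> C SC; exists C.
rewrite !setpowS => _ [H /SabP [A1 [B1 [P1 Q1 HE]]] [C SC <-]].
have [_ /SabP [A2 [B2 [P2 Q2 ->]]] CD] := IH C SC.
have oA1 := opset_opmx oP P1; have oB1 := opset_opmx oP Q1.
have oA2 := setpow_opmx oP P2; have oB2 := setpow_opmx oP Q2.
exists (hadamard s t (mxmul A1 A2) (mxtr (mxmul B2 B1))).
  exists (mxmul A1 A2); first by exists A1 => //; exists A2.
  exists (mxmul B2 B1) => //.
  by have := @setpow_mul_in Phi m 0 B2 B1 oP Q2 Q1; rewrite addn1.
move=> i j; rewrite mxtr_mul.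
apply: le_trans (hadamard_mul_le oA1 oA2 (opmx_tr oB1) (opmx_tr oB2) s0 t0 st i j).
have [C0 _] := setpow_opmx oS SC.
rewrite HE; apply: ler_mxmul => //; first exact: nonneg_hadamard.
  by apply: opmx_hadamard => //; exact: opmx_tr.
by apply: opmx_hadamard => //; exact: opmx_tr.
Qed.

Lemma dominated_Sab_sqr Phi m : opset Phi ->
  dominated (setpow (Sab s t Phi) (m.+1 + m.+1)) (setpow (Sab s t (setpow Phi 2)) m.+1).
Proof.
move=> oP; have oS := opset_Sab oP.
rewrite addnn -muln2 -(setpow_mul 1 m oS); apply: dominated_setpow.
- exact: opset_setpow.
- by apply: opset_Sab; exact: opset_setpow.
- exact: dominated_Sab.
Qed.

End Hadamard.
End SetPowers.

(** * The two essential radii of a bounded set *)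

Section SetRadii.
Variable R : realType.
Implicit Types (A B C : mx R) (S T Phi : set (mx R)) (c d e s t : R).

Lemma rho_ess_bound S c m A : 0 <= c -> (forall A, S A -> nonneg_mx A /\ mxbound A c) ->
  setpow S m.+1 A -> rho_ess A <= c ^+ m.+1.
Proof.
by move=> c0 h SA; have [A0 Ac] := setpow_bound h SA; exact: rho_ess_le.
Qed.

Lemma rho_ess_set_ge0 S : 0 <= rho_ess_set S.
Proof. by apply: sup_nonneg => _ [m _ <-]; exact: powR_ge0. Qed.

(** On [setpow S k.+1] the radius is at most c^(k+1), so the inner supremum and the supremum of the
    roots are over sets bounded above and do bound their members. *)
Lemma rho_ess_set_ub S m A : opset S -> setpow S m.+1 A ->
  rho_ess A <= rho_ess_set S ^+ m.+1.
Proof.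
move=> oS SA; have [c [c0 h]] := oS.
have sup_le k : sup [set rho_ess A | A in setpow S k.+1] <= c ^+ k.+1.
  apply: sup_le_nonneg; first exact: exprn_ge0.
  by move=> _ [B SB <-]; exact: rho_ess_bound SB.
have sup0 k : 0 <= sup [set rho_ess A | A in setpow S k.+1].
  by apply: sup_nonneg => _ [B SB <-]; apply: rho_ess_ge0; exact: setpow_opmx SB.
apply: (@le_trans _ _ (sup [set rho_ess A | A in setpow S m.+1])).
  apply: ub_le_sup; last by exists A.
  by exists (c ^+ m.+1) => _ [B SB <-]; exact: rho_ess_bound SB.
rewrite -(exprn_root (sup0 m) (ltn0Sn m)).
rewrite lerXn2r ?nnegrE ?powR_ge0 ?rho_ess_set_ge0 //.
apply: ub_le_sup; last by exists m.+1.
exists c => _ [[//|k] _ <-].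
rewrite -[leRHS](root_exprn c0 (ltn0Sn k)); apply: le_powR => //.
Qed.

Lemma rho_ess_set_le S d : opset S -> 0 <= d ->
  (forall m A, setpow S m.+1 A -> rho_ess A <= d ^+ m.+1) -> rho_ess_set S <= d.
Proof.
move=> oS d0 h; apply: sup_le_nonneg => // _ [[//|m] _ <-].
rewrite -[leRHS](root_exprn d0 (ltn0Sn m)); apply: le_powR.
- by apply: sup_nonneg => _ [B SB <-]; apply: rho_ess_ge0; exact: setpow_opmx SB.
- by rewrite invr_ge0.
- by apply: sup_le_nonneg; [exact: exprn_ge0|move=> _ [B SB <-]; exact: h].
Qed.

Definition suptau S m : R := sup [set tau A | A in setpow S m].

Lemma rho_hat_ess_setE S : opset S ->
  rho_hat_ess_set S = limn (fun m => suptau S m `^ m%:R^-1).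
Proof.
move=> oS; congr (limn _); apply/funext => m; congr (sup _ `^ _).
by apply/seteqP; split=> _ [A SA <-]; exists A; rewrite ?hmnc_tau //; exact: setpow_opmx SA.
Qed.

Lemma suptau_ge0 S m : opset S -> 0 <= suptau S m.
Proof.
by move=> oS; apply: sup_nonneg => _ [A SA <-]; apply: tau_ge0; exact: setpow_opmx SA.
Qed.

Lemma tau_le_suptau S m A : opset S -> setpow S m.+1 A -> tau A <= suptau S m.+1.
Proof.
move=> [c [c0 h]] SA; apply: ub_le_sup; last by exists A.
by exists (c ^+ m.+1) => _ [B SB <-]; have [B0 Bc] := setpow_bound h SB; exact: tau_le_bound.
Qed.

Lemma rho_hat_ess_cvg S : opset S ->
  suptau S m `^ m%:R^-1 @[m --> \oo] --> rho_hat_ess_set S.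
Proof.
move=> oS; rewrite rho_hat_ess_setE //.
apply: submultiplicative_root_cvg => [m|[//|m] [//|n] _ _]; first exact: suptau_ge0.
apply: sup_le_nonneg; first by rewrite mulr_ge0 ?suptau_ge0.
move=> _ [C SC <-]; have [A [B [SA SB ->]]] := setpow_split oS SC.
have oA := setpow_opmx oS SA; have oB := setpow_opmx oS SB.
apply: le_trans (tau_mul oA oB) _.
by apply: ler_pM; rewrite ?tau_ge0 ?tau_le_suptau.
Qed.

Lemma rho_hat_ess_set_ge0 S : opset S -> 0 <= rho_hat_ess_set S.
Proof.
move=> oS; apply: (lim_le_lim _ (cvg_cst 0) (rho_hat_ess_cvg oS)) => m _.
exact: powR_ge0.
Qed.

Lemma suptau_dominated S T m n : opset S -> opset T ->
  dominated (setpow S m) (setpow T n.+1) -> suptau S m <= suptau T n.+1.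
Proof.
move=> oS oT ST; apply: sup_le_nonneg; first exact: suptau_ge0.
move=> _ [A SA <-]; have [B TB AB] := ST A SA.
have oA := setpow_opmx oS SA; have oB := setpow_opmx oT TB.
by apply: le_trans (tau_le_suptau oT TB); apply: tau_mono => //; case: oA.
Qed.

Section Exponents.
Variables (s t : R).
Hypotheses (s0 : 0 <= s) (t0 : 0 <= t) (st : 1 <= s + t).

(** What the chain of inequalities needs from r; both radii satisfy it, so the final argument is
    carried out once. *)
Record submultiplicative_radius (r : set (mx R) -> R) := {
  radius_ge0 : forall S, opset S -> 0 <= r S;
  radius_Sab_sqr : forall S, opset S ->
    r (Sab s t S) <= r (Sab s t (setpow S 2)) `^ 2^-1;
  radius_Sab : forall S, opset S -> r (Sab s t S) <= r S `^ (s + t);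
  radius_setpow : forall S k, opset S -> r (setpow S k.+1) <= r S ^+ k.+1 }.

Lemma rho_ess_set_radius : submultiplicative_radius (@rho_ess_set R).
Proof.
split=> S; first by move=> _; exact: rho_ess_set_ge0.
- move=> oS; have oH := opset_Sab s0 t0 st oS.
  have oH2 := opset_Sab s0 t0 st (opset_setpow 1 oS).
  apply: rho_ess_set_le => // [|m A HA]; first exact: powR_ge0.
  have oA := setpow_opmx oH HA.
  (* Squaring doubles the number of factors: rho_ess A ^+ 2 is rho_ess of A A, a product of 2(m+1)
     members, which is dominated by a product of m+1 members of [Sab s t (setpow S 2)]. *)
  rewrite -(@ler_pXn2r _ 2) ?nnegrE ?rho_ess_ge0 ?exprn_ge0 ?powR_ge0 //.
  rewrite -rho_ess_sqr // exprAC (exprn_root (rho_ess_set_ge0 _)) //.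
  have [B HB AB] := dominated_Sab_sqr s0 t0 st oS (setpow_mul_in oH HA HA).
  apply: le_trans (rho_ess_set_ub oH2 HB); apply: rho_ess_mono => //.
    by case: (opmx_mul oA oA).
  exact: setpow_opmx HB.
- move=> oS; have oH := opset_Sab s0 t0 st oS.
  have r0 := rho_ess_set_ge0 S.
  apply: rho_ess_set_le => // [|m A HA]; first exact: powR_ge0.
  have oA := setpow_opmx oH HA; have [A0 _] := oA.
  have [_ /SabP [X [Y [SX SY ->]]] AXY] := dominated_Sab s0 t0 st oS HA.
  have oX := setpow_opmx oS SX; have oY := setpow_opmx oS SY.
  have oXY := opmx_hadamard oX (opmx_tr oY) s0 t0 st.
  apply: le_trans (rho_ess_mono A0 AXY oXY) _.
  apply: le_trans (rho_ess_hadamard oX oY s0 t0 st) _.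
  rewrite -powR_exprAC // powR_addM //.
  by apply: ler_pM; rewrite ?powR_ge0 //; apply: le_powR; rewrite ?rho_ess_ge0 ?rho_ess_set_ub.
- move=> k oS; apply: rho_ess_set_le; first exact: opset_setpow.
    by rewrite exprn_ge0 // rho_ess_set_ge0.
  move=> m A; rewrite setpow_mul // -exprM mulnC => SA.
  exact: rho_ess_set_ub.
Qed.

Lemma rho_hat_ess_set_radius : submultiplicative_radius (@rho_hat_ess_set R).
Proof.
split=> S; first exact: rho_hat_ess_set_ge0.
- move=> oS; have oH := opset_Sab s0 t0 st oS.
  have oH2 := opset_Sab s0 t0 st (opset_setpow 1 oS).
  have h : (suptau (Sab s t (setpow S 2)) m `^ m%:R^-1) `^ 2^-1 @[m --> \oo] -->
    rho_hat_ess_set (Sab s t (setpow S 2)) `^ 2^-1.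
    apply: cvg_powR; [by rewrite invr_ge0|by move=> n; exact: powR_ge0|].
    exact: rho_hat_ess_cvg.
  (* The left side is followed along even indices 2m, where the exponent 1/(2m) factors as 1/m times
     1/2. *)
  apply: (lim_le_lim _ (cvg_even (rho_hat_ess_cvg oH)) h) => -[//|m] _.
  rewrite -powRrM -invfM.
  have -> : m.+1%:R * 2 = (m.+1 + m.+1)%:R :> R by rewrite natrD; ring.
  apply: le_powR; [exact: suptau_ge0|by rewrite invr_ge0|].
  by apply: suptau_dominated => //; exact: dominated_Sab_sqr.
- move=> oS; have oH := opset_Sab s0 t0 st oS.
  have h : (suptau S m `^ m%:R^-1) `^ (s + t) @[m --> \oo] --> rho_hat_ess_set S `^ (s + t).
    apply: cvg_powR; [by rewrite addr_ge0|by move=> n; exact: powR_ge0|].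
    exact: rho_hat_ess_cvg.
  apply: (lim_le_lim _ (rho_hat_ess_cvg oH) h) => -[//|m] _.
  rewrite powRAC; apply: le_powR; [exact: suptau_ge0|by rewrite invr_ge0|].
  apply: sup_le_nonneg; first exact: powR_ge0.
  move=> _ [A HA <-]; have oA := setpow_opmx oH HA; have [A0 _] := oA.
  have [_ /SabP [X [Y [SX SY ->]]] AXY] := dominated_Sab s0 t0 st oS HA.
  have oX := setpow_opmx oS SX; have oY := setpow_opmx oS SY.
  have oXY := opmx_hadamard oX (opmx_tr oY) s0 t0 st.
  apply: le_trans (tau_mono A0 AXY oXY) _.
  apply: le_trans (tau_hadamard oX (opmx_tr oY) s0 t0 st) _.
  rewrite tau_tr // powR_addM //.
  by apply: ler_pM; rewrite ?powR_ge0 //; apply: le_powR; rewrite ?tau_ge0 ?tau_le_suptau.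
- move=> k oS; have oSk := opset_setpow k oS.
  have k0 : (k.+1%:R : R) != 0 by rewrite pnatr_eq0.
  (* The m-th roots for [setpow S k.+1] are the (k+1)-st powers of a subsequence of the roots for
     S. *)
  have h : (suptau S (m * k.+1) `^ (m * k.+1)%:R^-1) `^ k.+1%:R @[m --> \oo] -->
    rho_hat_ess_set S `^ k.+1%:R.
    apply: cvg_powR; [by []|by move=> n; exact: powR_ge0|].
    apply: (cvg_subseq (f := fun m => m * k.+1)%N _ (rho_hat_ess_cvg oS)) => n.
    by rewrite ltn_mul2r /=.
  rewrite -powR_mulrn ?rho_hat_ess_set_ge0 //.
  apply: (lim_le_lim _ (rho_hat_ess_cvg oSk) h) => -[//|m] _.
  rewrite -powRrM natrM invfM mulfVK // /suptau setpow_mul //.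
Qed.

End Exponents.
End SetRadii.

Theorem theorem4p3 (R : realType) (Psi : set (mx R))
  (r : set (mx R) -> R) (alpha beta : R) :
  (forall A, Psi A -> nonneg_mx A /\ defines_operator A) ->
  bdd_opset Psi ->
  (r = @rho_ess_set R \/ r = @rho_hat_ess_set R) ->
  0 <= alpha -> 0 <= beta -> 1 <= alpha + beta ->
  let rn := fun n : nat =>
    r (Sab alpha beta (setpow Psi (2 ^ n))) `^ ((2 ^+ n)^-1 : R) in
  forall n : nat,
    r (Sab alpha beta Psi) = rn 0%N /\
    (forall k : nat, (k < n)%N -> rn k <= rn k.+1) /\
    rn n <= r Psi `^ (alpha + beta).
Proof.
move=> hPsi [C hC] hr a0 b0 ab rn n.
have oP : opset Psi.
  (* An empty Psi allows a negative C, while [opset] asks for a nonnegative constant. *)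
  exists (Num.max 0 C); split=> [|A PA]; first by rewrite le_max lexx.
  have [A0 dA] := hPsi A PA; split=> //.
  have oA : opmx A by split=> //; exact: defines_operator_bounded.
  apply: mxbound_le (mxbound_opnorm oA).
  by rewrite le_max (hC A PA) orbT.
have hrad : submultiplicative_radius alpha beta r.
  by case: hr => ->; [exact: rho_ess_set_radius|exact: rho_hat_ess_set_radius].
have pos k : exists p, (2 ^ k = p.+1)%N by exists (2 ^ k).-1; rewrite prednK // expn_gt0.
have oPk k : opset (setpow Psi (2 ^ k)).
  by have [p ->] := pos k; exact: opset_setpow.
have oSk k : opset (Sab alpha beta (setpow Psi (2 ^ k))) by exact: opset_Sab.
(* Raising x to the real power 1 returns x only for x >= 0, so the identity with r_0 uses
   nonnegativity of r. *)
split; first by rewrite /rn expr0 invr1 powRr1 // (radius_ge0 hrad) //; exact: oSk 0%N.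
split=> [k _|].
  (* The exponent 2^-(k+1) splits into 1/2, the root in the two-factor estimate for Psi^(2^k), and
     the common exponent 2^-k. *)
  rewrite /rn [in leRHS]exprS invfM powRrM.
  have -> : setpow Psi (2 ^ k.+1) = setpow (setpow Psi (2 ^ k)) 2.
    by rewrite expnS; have [p ->] := pos k; rewrite setpow_mul.
  apply: le_powR; [exact: (radius_ge0 hrad)|by rewrite invr_ge0 exprn_ge0|].
  exact: (radius_Sab_sqr hrad).
rewrite /rn; have [p hp] := pos n.
have rP0 := radius_ge0 hrad oP.
(* The bound r(Psi^(2^n)) <= r(Psi)^(2^n) is what cancels the root of order 2^n. *)
apply: (@le_trans _ _ (((r Psi ^+ (2 ^ n)) `^ (alpha + beta)) `^ (2 ^+ n)^-1)).
  apply: le_powR; [exact: (radius_ge0 hrad)|by rewrite invr_ge0 exprn_ge0|].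
  apply: le_trans (radius_Sab hrad (oPk n)) _.
  apply: le_powR; [exact: (radius_ge0 hrad)|by rewrite addr_ge0|].
  by rewrite hp; exact: (radius_setpow hrad).
by rewrite powRAC -natrX root_exprn // expn_gt0.
Qed.
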